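(* Let $(X,R)$ be a wac tournament. Then $(X,R)$ has a classifier system $\{(X_i,R_i,f_i)\}_{i\in\mathbb N}$ with maps $\{h_i\}$, and it is unique up to isomorphism: if $\{(X_i',R_i',f_i')\}$ with maps $\{h_i'\}$ is another classifier system for $(X,R)$, then there exist isomorphisms $q_i:(X_i,R_i)\to(X_i',R_i')$ with $f_i'\circ q_{i+1}=q_i\circ f_i$ and $q_i\circ h_i=h_i'$ for all $i$. For any classifier system, the product map $x\mapsto (h_i(x))_{i\in\mathbb N}$ is an isomorphism from $(X,R)$ to the inverse limit of $\{(X_i,R_i,f_i)\}$. Furthermore, the classifier system can be constructed so that for every $i$, $(X_{i+1},R_{i+1})$ is a compact topological lexicographic product $(X_i,R_i)\ltimes\{(Y_{ix_i},S_{ix_i}):x_i\in X_i\}$ with each $(Y_{ix_i},S_{ix_i})$ either prime, a nontrivial finite order, or trivial (and with $f_i$ the first coordinate projection).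
   Context: All spaces are Hausdorff. A tournament on a nonempty set $X$ is a relation $R\subset X\times X$ with $R\cap R^{-1}=1_X=\{(x,x):x\in X\}$ and $R\cup R^{-1}=X\times X$. Its set of arcs is $R^\circ=R\setminus 1_X$. It is trivial if $X$ is a singleton and an arc if $|X|=2$; an order is a transitive tournament. For $A\subset X$, $R|A=R\cap(A\times A)$. $(X,R)$ is a compact topological tournament when $X$ is compact and $R$ is closed in $X\times X$. A 3-cycle is a triple of distinct points with $(x_1,x_2),(x_2,x_3),(x_3,x_1)\in R^\circ$. A cycle point is a point $x$ such that every neighborhood of $x$ contains a 3-cycle including $x$. A wac tournament is a compact topological tournament in which every non-isolated point is a cycle point. For compact topological tournaments a quotient map $h:(X_2,R_2)\to(X_1,R_1)$ is a surjective continuous map with $(h\times h)(R_2)\subset R_1$; it is an isomorphism if also injective. An arc quotient is a quotient map onto an arc. A nontrivial compact topological tournament is prime when its only quotient maps onto nontrivial tournaments are isomorphisms; a prime quotient map is a quotient map onto a prime tournament. If $L$ is a linear order on a finite set $Y$ with $|Y|\ge2$, a maximum order quotient map $h:(X,R)\to(Y,L)$ is a quotient map such that for each $y\in Y$ the restriction $R|h^{-1}(y)$ has no arc quotient. A base quotient map of a wac tournament $(X,R)$ is: a prime quotient map if $(X,R)$ is nontrivial and has no arc quotient; a maximum order quotient map if $(X,R)$ has an arc quotient; the map onto a trivial tournament if $(X,R)$ is trivial. (Base quotient maps exist and are unique up to isomorphism.) A classifier system for a wac tournament $(X,R)$ is a sequence $\{(X_i,R_i,f_i)\}_{i\in\mathbb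 N}$ of compact topological tournaments $(X_i,R_i)$ and quotient maps $f_i:(X_{i+1},R_{i+1})\to(X_i,R_i)$, together with quotient maps $h_i:(X,R)\to(X_i,R_i)$ such that (i) $h_i=f_i\circ h_{i+1}$ for all $i$; (ii) $h_1$ is a base quotient map; (iii) for each $x_i\in X_i$ the restriction $(h_i^{-1}(x_i),R|h_i^{-1}(x_i))$ is a wac tournament and $h_{i+1}:(h_i^{-1}(x_i),R|h_i^{-1}(x_i))\to(f_i^{-1}(x_i),R_{i+1}|f_i^{-1}(x_i))$ is a base quotient map. The inverse limit of $\{(X_i,R_i,f_i)\}$ is $\{x\in\prod_iX_i: f_i(x_{i+1})=x_i\ \forall i\}$ with the relation consisting of pairs $(x,x')$ with $(x_i,x_i')\in R_i$ for all $i$. The lexicographic product $(X_1,R_1)\ltimes\{(Y_x,S_x):x\in X_1\}$ is the tournament on $X_2=\bigcup_{x\in X_1}\{x\}\times Y_x$ with $((x,y),(x',y'))$ in the relation iff $(x,x')\in R_1^\circ$, or $x=x'$ and $(y,y')\in S_x$. It is a compact topological lexicographic product when $X_1$ and all $Y_x$ are compact (topological tournaments), $(Y_x,S_x)$ is trivial whenever $x$ is non-isolated in $X_1$, and $X_2$ has the topology with basis the sets $\pi^{-1}(V)$ with $V$ open in $X_1$ ($\pi$ the first coordinate projection) and $\{x\}\times V$ with $x$ isolated in $X_1$ and $V$ open in $Y_x$. *)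

(* Defs.v *)
From HB Require Import structures.
From mathcomp Require Import all_boot.
From mathcomp Require Import all_classical.
From mathcomp Require Import topology function_spaces.

Set Implicit Arguments.
Unset Strict Implicit.
Unset Printing Implicit Defensive.

Local Open Scope classical_set_scope.
Local Open Scope relation_scope.

(* A bare topological space with a binary relation.  Being a compact topological
   tournament is the separate predicate [ct_tournament], so that restrictions,
   products and lexicographic products are total operations. *)
Record relSpace := RelSpace {
  space :> topologicalType;
  tr : set (space * space) }.
Arguments tr : clear implicits.

Definition tournament (X : Type) (R : set (X * X)) : Prop :=
  [/\ [set: X] !=set0, R `&` R^-1 = diagonal & R `|` R^-1 = setT].

Definition ct_tournament (X : relSpace) : Prop :=
  [/\ hausdorff_space X, compact [set: X], tournament (tr X) & closed (tr X)].

Definition arcs (X : relSpace) : set (X * X) := tr X `\` diagonal.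
Arguments arcs : clear implicits.

Definition trivial_tournament (X : relSpace) : Prop :=
  exists x : X, [set: X] = [set x].

Definition is_arc (X : relSpace) : Prop :=
  exists x y : X, x <> y /\ [set: X] = [set x; y].

Definition is_order (X : relSpace) : Prop :=
  ct_tournament X /\
  forall x y z : X, tr X (x, y) -> tr X (y, z) -> tr X (x, z).

Definition nontrivial_finite_order (X : relSpace) : Prop :=
  [/\ is_order X, finite_set [set: X] & ~ trivial_tournament X].

Definition restr (X : relSpace) (A : set X) : relSpace :=
  @RelSpace (set_type A) [set p | tr X (set_val p.1, set_val p.2)].

Definition three_cycle (X : relSpace) (a b c : X) : Prop :=
  [/\ a <> b, b <> c & c <> a] /\
  [/\ arcs X (a, b), arcs X (b, c) & arcs X (c, a)].

Definition cycle_point (X : relSpace) (x : X) : Prop :=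
  forall U : set X, nbhs x U -> exists a b c : X,
    [/\ three_cycle a b c, [set a; b; c] `<=` U & [set a; b; c] x].

Definition wac_tournament (X : relSpace) : Prop :=
  ct_tournament X /\
  forall x : X, ~ isolated [set: X] x -> cycle_point x.

Definition quotient_map (X Y : relSpace) (h : X -> Y) : Prop :=
  [/\ ct_tournament X, ct_tournament Y, set_surj [set: X] [set: Y] h,
      continuous h &
      forall x x' : X, tr X (x, x') -> tr Y (h x, h x')].

Definition isomorphism (X Y : relSpace) (h : X -> Y) : Prop :=
  quotient_map h /\ injective h.

Definition has_arc_quotient (X : relSpace) : Prop :=
  exists (Y : relSpace) (h : X -> Y), is_arc Y /\ quotient_map h.

Definition prime_tournament (X : relSpace) : Prop :=
  [/\ ct_tournament X, ~ trivial_tournament X &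
      forall (Y : relSpace) (h : X -> Y),
        ~ trivial_tournament Y -> quotient_map h -> isomorphism h].

Definition prime_quotient_map (X Y : relSpace) (h : X -> Y) : Prop :=
  quotient_map h /\ prime_tournament Y.

Definition maximum_order_quotient_map (X Y : relSpace) (h : X -> Y) : Prop :=
  [/\ quotient_map h, nontrivial_finite_order Y &
      forall y : Y, ~ has_arc_quotient (restr (h @^-1` [set y]))].

Definition base_quotient_map (X Y : relSpace) (h : X -> Y) : Prop :=
  [/\ ~ trivial_tournament X /\ ~ has_arc_quotient X -> prime_quotient_map h,
      has_arc_quotient X -> maximum_order_quotient_map h &
      trivial_tournament X -> quotient_map h /\ trivial_tournament Y].

(* Indexing starts at 0.  The restriction of [h i.+1] to the fibre over [x] is
   the unique map [g] between the two fibres (as subspaces) which commutes with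
   the inclusions. *)
Definition classifier_system (X : relSpace) (Xs : nat -> relSpace)
    (f : forall i, Xs i.+1 -> Xs i) (h : forall i, X -> Xs i) : Prop :=
  [/\ (forall i, ct_tournament (Xs i)),
      (forall i, quotient_map (f i)) &
      (forall i, quotient_map (h i))] /\
  [/\ (forall i, h i =1 f i \o h i.+1),
      base_quotient_map (h 0) &
      forall i (x : Xs i),
        wac_tournament (restr (h i @^-1` [set x])) /\
        exists g : restr (h i @^-1` [set x]) -> restr (f i @^-1` [set x]),
          (forall z, set_val (g z) = h i.+1 (set_val z)) /\
          base_quotient_map g].

Definition product_relSpace (Xs : nat -> relSpace) : relSpace :=
  @RelSpace (prod_topology Xs)
    [set p | forall i, tr (Xs i) (p.1 i, p.2 i)].

Definition inverse_limit (Xs : nat -> relSpace)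
    (f : forall i, Xs i.+1 -> Xs i) : relSpace :=
  @restr (product_relSpace Xs) [set x | forall i, f i (x i.+1) = x i].

(* An alias, because the library puts the disjoint union topology on
   [{x : X & Y x}]. *)
Definition lex_space (X : relSpace) (Y : X -> relSpace) : Type :=
  {x : X & Y x}.

Section LexTopology.
Variables (X : relSpace) (Y : X -> relSpace).
Local Notation T := (lex_space Y).

Definition lex_fst (p : T) : X := projT1 p.

Definition lex_base : set (set T) :=
  [set lex_fst @^-1` V | V in [set V : set X | open V]] `|`
  [set W | exists (x : X) (V : set (Y x)),
     [/\ isolated [set: X] x, open V & W = existT (fun x => Y x) x @` V]].

Lemma lex_base_cover : \bigcup_(W in lex_base) W = setT.
Proof.
rewrite predeqE => t; split => // _; exists setT => //.
by left; exists setT; [exact: openT|].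
Qed.

Lemma lex_base_join (A B : set T) (t : T) :
  lex_base A -> lex_base B -> A t -> B t ->
  exists C, [/\ lex_base C, C t & C `<=` A `&` B].
Proof.
move=> bA bB At Bt; case: (bA) => [[V oV VA]|[x [V [ix oV VA]]]].
  case: (bB) => [[W oW WB]|[x [W [ix oW WB]]]].
    exists (A `&` B); split => //; left; exists (V `&` W); first exact: openI.
    by rewrite -VA -WB.
  exists B; split => // s Bs; split => //.
  move: At Bt Bs; rewrite -VA WB => + [y _ e] [z _ e'].
  by rewrite -e -e'.
case: (bB) => [[W oW WB]|[x' [W [ix' oW WB]]]].
  exists A; split => // s As; split => //.
  move: Bt At As; rewrite VA -WB => + [y _ e] [z _ e'].
  by rewrite -e -e'.
move: At; rewrite {1}VA => -[y Vy e].
move: Bt; rewrite {1}WB => -[y' Wy' e'].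
have ? : x' = x by rewrite -[LHS]/(lex_fst (existT _ x' y')) e' -e.
subst x'.
have yy : y' = y by apply: eq_from_Tagged (etrans e' (esym e)).
exists (existT (fun x => Y x) x @` (V `&` W)); split.
- by right; exists x, (V `&` W); split => //; exact: openI.
- by exists y => //; split => //; rewrite -yy.
- by move=> _ [z [Vz Wz] <-]; rewrite VA WB; split; exists z.
Qed.

HB.instance Definition _ := Choice.copy T {x : X & Y x}.
HB.instance Definition _ := isBaseTopological.Build T
  lex_base_cover lex_base_join.

End LexTopology.

Definition lex_product (X : relSpace) (Y : X -> relSpace) : relSpace :=
  @RelSpace (lex_space Y)
    [set p | arcs X (lex_fst p.1, lex_fst p.2) \/
       exists (x : X) (y y' : Y x),
         p = (existT _ x y, existT _ x y') /\ tr (Y x) (y, y')].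

Definition ct_lex_conditions (X : relSpace) (Y : X -> relSpace) : Prop :=
  [/\ ct_tournament X, (forall x, ct_tournament (Y x)) &
      forall x : X, ~ isolated [set: X] x -> trivial_tournament (Y x)].

(* [X'] with [f : X' -> X] is literally the compact topological lexicographic
   product of the [Y x] over [X] with its first projection; the equality of
   dependent pairs identifies the spaces and the maps at once. *)
Definition is_ct_lex_product (X : relSpace) (Y : X -> relSpace)
    (X' : relSpace) (f : X' -> X) : Prop :=
  ct_lex_conditions Y /\
  existT (fun Z : relSpace => Z -> X) X' f =
  existT (fun Z : relSpace => Z -> X) (lex_product Y) (@lex_fst X Y).

(* Main.v *)
Require Import Defs.
From mathcomp Require Import all_boot all_classical topology function_spaces.
From mathcomp Require Import generic_quotient.

(** Write x -> y when (x, y) belongs to the relation. A module of a tournament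
    is a set A such that every point outside A is before all of A or after all
    of A. The proof rests on a rigidity property of wac tournaments: a module
    with at least two points is clopen ([wac_module_clopen]). Indeed, at a
    boundary point x of A, outside points accumulate on one side of A, and the
    small 3-cycles through x have to leave A and come back on the other side; in
    the limit every point of A is both before and after x ([module_boundary]).

    The fibres of a quotient map are modules. Conversely, in a wac tournament
    every equivalence relation whose classes are modules is the kernel of a
    quotient map ([module_quotient_exists]): the classes are clopen or
    singletons, and two singleton classes {a}, {b} that are not open are
    separated by the points before and after some c, because {a, b} is not a
    module.

    This reduces base quotient maps to two relations defined without reference
    to them. With an arc quotient, two points are identified when no cut
    separates them ([uncut]); the classes are open since they contain the small
    3-cycles at their points, hence are finite in number, and the quotient is an
    order. Without one, two points are identified when a proper module contains
    both ([cohabit]); this is transitive because two proper modules that meet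
    and cover X would give a cut, and a class is proper by compactness. Every
    base quotient map has the corresponding kernel ([base_kernel_unique]), so
    base quotient maps exist and are unique up to isomorphism.

    A classifier system is built by replacing each point of a level by the base
    quotient of its fibre, in the lexicographic product topology. This is a
    quotient of X because the fibres over points that are not isolated are
    singletons ([lex_lift_quotient]). Uniqueness holds since, inductively, the
    kernels of two systems agree at each level ([classifier_kernel]). Finally
    the maps of a system separate points: otherwise a decreasing sequence of
    fibres would intersect in a module with two points, which is open, so the
    sequence would be stationary by compactness, although a nontrivial fibre is
    always split by its base quotient map ([classifier_separates]). *)

Set Implicit Arguments.
Unset Strict Implicit.
Unset Printing Implicit Defensive.

Local Open Scope classical_set_scope.

(** * Compact spaces and compact tournaments *)

(** Compactness for covers that absorb finite unions: it serves for proper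
    modules through a point, for nested fibres, and for the sets with finite
    image. *)
Lemma compact_directed_cover (T : topologicalType) (P : set (set T)) :
  compact [set: T] -> P !=set0 -> (forall A, P A -> open A) ->
  (forall A B, P A -> P B -> exists2 C, P C & A `|` B `<=` C) ->
  (forall x, exists2 A, P A & A x) -> P setT.
Proof.
move=> cT [A0 PA0] oP dP cP; apply: contrapT => nPT.
have FF : ProperFilter (filter_from P (fun A => ~` A)).
  apply: filter_from_proper; first apply: filter_from_filter.
  - by exists A0.
  - move=> A B PA PB; have [C PC sC] := dP A B PA PB.
    by exists C => // x nC; split=> ?; apply: nC; apply: sC; [left|right].
  - move=> A PA; apply/set0P/eqP => A0'; apply: nPT.
    by rewrite -setC0 -A0' setCK.
have [|x [_ clx]] := cT _ FF; first by exists A0.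
have [A PA Ax] := cP x.
have [||y []//] := clx (~` A) A; first by exists A.
by apply: open_nbhs_nbhs; split => //; exact: oP.
Qed.

Lemma isolated_setTP (T : topologicalType) (x : T) :
  isolated [set: T] x <-> open [set x].
Proof.
split=> [[_ [V nV]]|ox]; last first.
  split; first by rewrite inE.
  by exists [set x]; rewrite ?setIT //; exact: open_nbhs_nbhs.
by rewrite setIT => VE; rewrite openE => _ ->; rewrite /interior -VE.
Qed.

Lemma openP_nbhs (T : topologicalType) (A : set T) :
  (forall x, A x -> nbhs x A) -> open A.
Proof. by move=> nA; rewrite openE. Qed.

Lemma not_nbhsP (T : topologicalType) (A U : set T) (x : T) :
  ~ nbhs x A -> nbhs x U -> exists2 z, U z & ~ A z.
Proof.
move=> nA nU; apply: contrapT => nE; apply: nA; apply: filterS nU => z Uz.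
by apply: contrapT => nAz; apply: nE; exists z.
Qed.

Section CompactTournament.
Variables (X : relSpace) (ctX : ct_tournament X).
Implicit Types (x y z : X) (A B : set X).

Lemma ct_hausdorff : hausdorff_space X. Proof. by case: ctX. Qed.
Lemma ct_compact : compact [set: X]. Proof. by case: ctX. Qed.
Lemma ct_closed1 x : closed [set x].
Proof. exact/accessible_closed_set1/hausdorff_accessible/ct_hausdorff. Qed.
Lemma ct_ex : exists x : X, True. Proof. by case: ctX => _ _ [[x]]; exists x. Qed.

Lemma tr_refl x : tr X (x, x).
Proof.
case: ctX => _ _ [_ trI _] _; suff : (tr X `&` (tr X)^-1%relation) (x, x) by case.
by rewrite trI.
Qed.

Lemma tr_total x y : tr X (x, y) \/ tr X (y, x).
Proof.
case: ctX => _ _ [_ _ trU] _.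
by suff : (tr X `|` (tr X)^-1%relation) (x, y) by []; rewrite trU.
Qed.

Lemma tr_anti x y : tr X (x, y) -> tr X (y, x) -> x = y.
Proof.
case: ctX => _ _ [_ trI _] _ xy yx.
by suff : diagonal (x, y) by []; rewrite -trI; split.
Qed.

Lemma closed_tr_to x : closed [set u | tr X (u, x)].
Proof.
have c : continuous (fun u : X => (u, x)).
  by move=> u; apply: cvg_pair => /=; [exact: cvg_id|exact: cvg_cst].
by move/continuous_closedP: c; apply; case: ctX.
Qed.

Lemma closed_tr_from x : closed [set u | tr X (x, u)].
Proof.
have c : continuous (fun u : X => (x, u)).
  by move=> u; apply: cvg_pair => /=; [exact: cvg_cst|exact: cvg_id].
by move/continuous_closedP: c; apply; case: ctX.
Qed.

Lemma tr_cluster_l x y :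
  (forall U, nbhs x U -> exists2 u, U u & tr X (u, y)) -> tr X (x, y).
Proof.
move=> cl; apply: (closed_tr_to (x := y)) => U /cl[u Uu uy].
by exists u.
Qed.

Lemma tr_cluster_r x y :
  (forall U, nbhs y U -> exists2 u, U u & tr X (x, u)) -> tr X (x, y).
Proof.
move=> cl; apply: (closed_tr_from (x := x)) => U /cl[u Uu xu].
by exists u.
Qed.

End CompactTournament.

(** * Quotient maps *)

(** Compactness and closedness of the relation pass to the image for free: the
    relation of [Y] is the image of that of [X] under [h] times [h], because a
    pair of points of [Y] lifts to a pair of comparable points of [X]. *)
Lemma quotient_mapI {X Y : relSpace} {h : X -> Y} :
  ct_tournament X -> hausdorff_space Y ->
  (forall y y', tr Y (y, y') -> tr Y (y', y) -> y = y') ->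
  set_surj [set: X] [set: Y] h -> continuous h ->
  (forall x x', tr X (x, x') -> tr Y (h x, h x')) -> quotient_map h.
Proof.
move=> ctX hY aY sh ch hh; split => //; case: (ctX) => hX cX _ cR.
have imR : tr Y = (fun p => (h p.1, h p.2)) @` tr X.
  rewrite predeqE => -[y y']; split=> [yy'|[[x x'] /= xx' [<- <-]]]; last exact: hh.
  have [x _ hx] := sh y I; have [x' _ hx'] := sh y' I.
  have [xx'|x'x] := tr_total ctX x x'; first by exists (x, x'); rewrite //= hx hx'.
  have e : y = y' by apply: aY => //; rewrite -hx -hx'; exact: hh.
  by exists (x, x); rewrite /= ?hx ?e //; exact: tr_refl.
have c2 : continuous (fun p : X * X => (h p.1, h p.2)).
  move=> p; apply: cvg_pair => /=.
    by apply: continuous_comp; [exact: cvg_fst|exact: ch].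
  by apply: continuous_comp; [exact: cvg_snd|exact: ch].
split => //.
- have -> : [set: Y] = h @` setT by rewrite eqEsubset; split => // y _; exact: sh.
  by apply: continuous_compact => //; exact: continuous_subspaceT.
- split.
  + by have [x _] := ct_ex ctX; exists (h x).
  + rewrite predeqE => -[y y']; split=> [[/= yy' y'y]|/diagonalP /= <-].
      by apply/diagonalP => /=; exact: aY.
    have [x _ <-] := sh y I.
    by split => /=; apply: hh; exact: tr_refl.
  + rewrite predeqE => -[y y']; split => // _.
    have [x _ <-] := sh y I; have [x' _ <-] := sh y' I.
    by have [xx'|x'x] := tr_total ctX x x'; [left|right]; exact: hh.
- apply: compact_closed.
    move=> [y1 y2] [z1 z2] cl; congr pair; apply: hY => U V nU nV.
      have [||[a b] [/= [? ?] [? ?]]] := cl (U `*` setT) (V `*` setT).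
      + by exists (U, setT) => //; split => //; exact: filterT.
      + by exists (V, setT) => //; split => //; exact: filterT.
      + by exists a.
    have [||[a b] [/= [? ?] [? ?]]] := cl (setT `*` U) (setT `*` V).
    + by exists (setT, U) => //; split => //; exact: filterT.
    + by exists (setT, V) => //; split => //; exact: filterT.
    + by exists b.
  rewrite imR; apply: continuous_compact; first exact: continuous_subspaceT.
  apply: (subclosed_compact cR (compact_setX cX cX)).
  by move=> [a b] _; split.
Qed.

Section QuotientMap.
Variables (X Y : relSpace) (h : X -> Y) (qh : quotient_map h).

Lemma qm_dom : ct_tournament X. Proof. by case: qh. Qed.
Lemma qm_cod : ct_tournament Y. Proof. by case: qh. Qed.
Lemma qm_cont : continuous h. Proof. by case: qh. Qed.
Lemma qm_surj y : exists x, h x = y.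
Proof. by case: qh => _ _ /(_ y I)[x _ <-] _ _; exists x. Qed.
Lemma qm_tr x x' : tr X (x, x') -> tr Y (h x, h x').
Proof. by case: qh => _ _ _ _; exact. Qed.

(** Between different fibres the relation is pulled back from [Y]. *)
Lemma qm_lift x x' : h x <> h x' -> tr Y (h x, h x') -> tr X (x, x').
Proof.
move=> nh hxx'; have [//|x'x] := tr_total qm_dom x x'.
by case: nh; apply: (tr_anti qm_cod) => //; exact: qm_tr.
Qed.

Lemma qm_closed (C : set X) : closed C -> closed (h @` C).
Proof.
move=> cC; apply: compact_closed; first exact: ct_hausdorff qm_cod.
apply: continuous_compact; first exact/continuous_subspaceT/qm_cont.
by apply: (subclosed_compact cC (ct_compact qm_dom)).
Qed.

Lemma qm_closed_fibre y : closed (h @^-1` [set y]).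
Proof.
move/continuous_closedP: qm_cont; apply; exact: (ct_closed1 qm_cod).
Qed.

Lemma qm_open_fibre y : open (h @^-1` [set y]) -> open [set y].
Proof.
move=> oA; rewrite -closedC.
have -> : ~` [set y] = h @` (~` (h @^-1` [set y])).
  rewrite predeqE => z; split=> [zy|[x hx <-//]].
  by have [x hx] := qm_surj z; exists x => //= hxy; apply: zy; rewrite -hx.
exact/qm_closed/open_closedC.
Qed.

End QuotientMap.

Lemma quotient_map_comp (X Y Z : relSpace) (h : X -> Y) (g : Y -> Z) :
  quotient_map h -> quotient_map g -> quotient_map (g \o h).
Proof.
move=> qh qg; apply: quotient_mapI.
- exact: qm_dom qh.
- exact: ct_hausdorff (qm_cod qg).
- exact: (tr_anti (qm_cod qg)).
- move=> z _; have [y <-] := qm_surj qg z; have [x <-] := qm_surj qh y.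
  by exists x.
- by move=> x; apply: continuous_comp; [exact: (qm_cont qh)|exact: (qm_cont qg)].
- by move=> x x' xx'; apply: (qm_tr qg); exact: (qm_tr qh).
Qed.

(** A quotient map is closed, so [Y] carries the quotient topology and a
    function out of [Y] is continuous as soon as its pull-back is. *)
Lemma quotient_map_factor (X Y Z : relSpace) (h : X -> Y) (k : X -> Z) :
  quotient_map h -> quotient_map k ->
  (forall x x', h x = h x' -> k x = k x') ->
  exists2 q : Y -> Z, quotient_map q & q \o h =1 k.
Proof.
move=> qh qk hk; pose q y := k (projT1 (cid (qm_surj qh y))).
have qE : q \o h =1 k.
  by move=> x; apply: hk; exact: (projT2 (cid (qm_surj qh (h x)))).
exists q => //; apply: quotient_mapI.
- exact: qm_cod qh.
- exact: ct_hausdorff (qm_cod qk).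
- exact: (tr_anti (qm_cod qk)).
- by move=> z _; have [x <-] := qm_surj qk z; exists (h x) => //; exact: qE.
- apply/continuous_closedP => C cC.
  have -> : q @^-1` C = h @` (k @^-1` C).
    rewrite predeqE => y; split=> [|[x kx <-]]; last by rewrite /= -/((q \o h) x) qE.
    by have [x <-] := qm_surj qh y; rewrite /= -/((q \o h) x) qE; exists x.
  by apply: (qm_closed qh); move/continuous_closedP: (qm_cont qk); apply.
- move=> y y' yy'; have [x xy] := qm_surj qh y; have [x' xy'] := qm_surj qh y'.
  have [xx'|x'x] := tr_total (qm_dom qh) x x'.
    by have := qm_tr qk xx'; rewrite -!qE /= xy xy'.
  have -> : y = y'.
    by apply: (tr_anti (qm_cod qh)) => //; rewrite -xy -xy'; exact: (qm_tr qh).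
  exact: (tr_refl (qm_cod qk)).
Qed.

(** A quotient of [X] is determined up to isomorphism by its kernel; all the
    uniqueness statements below compare kernels only. *)
Lemma quotient_map_iso (X Y Z : relSpace) (h : X -> Y) (k : X -> Z) :
  quotient_map h -> quotient_map k ->
  (forall x x', h x = h x' <-> k x = k x') ->
  exists2 q : Y -> Z, isomorphism q & q \o h =1 k.
Proof.
move=> qh qk hk; have [|q qq qE] := @quotient_map_factor _ _ _ h k qh qk.
  by move=> x x' /hk.
exists q => //; split => // y y'.
have [x <-] := qm_surj qh y; have [x' <-] := qm_surj qh y'; move=> e.
by apply/hk; rewrite -!qE.
Qed.

Lemma id_isomorphism (X : relSpace) : ct_tournament X -> isomorphism (@id X).
Proof.
move=> ctX; split => //; split => //.
by move=> x; exact: cvg_id.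
Qed.

(** * Modules *)

(** Also known as an interval, or autonomous set, of the tournament. *)
Definition module (X : relSpace) (A : set X) : Prop :=
  forall w, ~ A w -> (forall a, A a -> tr X (w, a)) \/ (forall a, A a -> tr X (a, w)).

Section Modules.
Variables (X : relSpace) (ctX : ct_tournament X).
Implicit Types (x y z a b c w : X) (A B U : set X).

Lemma module_from A w a b :
  module A -> ~ A w -> A a -> A b -> tr X (w, a) -> tr X (w, b).
Proof.
move=> mA nw Aa Ab wa; have [/(_ _ Ab)//|aw] := mA _ nw.
by case: nw; rewrite (tr_anti ctX wa (aw _ Aa)).
Qed.

Lemma module_to A w a b :
  module A -> ~ A w -> A a -> A b -> tr X (a, w) -> tr X (b, w).
Proof.
move=> mA nw Aa Ab aw; have [wa|/(_ _ Ab)//] := mA _ nw.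
by case: nw; rewrite (tr_anti ctX (wa _ Aa) aw).
Qed.

(** A common point [c] forces the two directions to agree. *)
Lemma module_setU A B c : module A -> module B -> A c -> B c -> module (A `|` B).
Proof.
move=> mA mB Ac Bc w /not_orP[nA nB].
have [wc|cw] := tr_total ctX w c; [left|right] => d [Ad|Bd].
- exact: (module_from mA nA Ac).
- exact: (module_from mB nB Bc).
- exact: (module_to mA nA Ac).
- exact: (module_to mB nB Bc).
Qed.

Lemma module_closure A : module A -> module (closure A).
Proof.
move=> mA w nw; have nAw : ~ A w by move=> /subset_closure.
have [wA|Aw] := mA _ nAw; [left|right] => a cla.
  by apply: (tr_cluster_r ctX) => U /cla[u [Au Uu]]; exists u => //; exact: wA.
by apply: (tr_cluster_l ctX) => U /cla[u [Au Uu]]; exists u => //; exact: Aw.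
Qed.

Lemma module_fibre (Y : relSpace) (h : X -> Y) (y : Y) :
  quotient_map h -> module (h @^-1` [set y]).
Proof.
move=> qh w hw; have [wy|yw] := tr_total (qm_cod qh) (h w) y; [left|right] => a /= ha.
  by apply: (qm_lift qh); rewrite ha.
by apply: (qm_lift qh); rewrite ha // => e; exact: hw.
Qed.

Lemma cycle_pointE x U : cycle_point x -> nbhs x U ->
  exists b c, [/\ U b, U c & [/\ x <> b, b <> c & c <> x]] /\
    [/\ tr X (x, b), tr X (b, c) & tr X (c, x)].
Proof.
move=> cx nU; have [a [b [c [[[ab bc ca] [[aab _] [abc _] [aca _]]] sU xabc]]]] := cx U nU.
have Ua : U a by apply: sU; left; left.
have Ub : U b by apply: sU; left; right.
have Uc : U c by apply: sU; right.
by case: xabc => [[]|] ->; [exists b, c|exists c, a|exists a, b].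
Qed.

Lemma cycle_point_not_source x A :
  cycle_point x -> nbhs x A -> ~ (forall a, A a -> tr X (x, a)).
Proof.
move=> cx nA xA; have [b [c [[_ Ac [_ _ nc]] [_ _ cx']]]] := cycle_pointE cx nA.
by apply: nc; apply: (tr_anti ctX) => //; exact: xA.
Qed.

Lemma cycle_point_not_target x A :
  cycle_point x -> nbhs x A -> ~ (forall a, A a -> tr X (a, x)).
Proof.
move=> cx nA Ax; have [b [c [[Ab _ [nb _ _]] [xb _ _]]]] := cycle_pointE cx nA.
by apply: nb; apply: (tr_anti ctX) => //; exact: Ax.
Qed.

(** Points outside A accumulate at x, either after A or before A. If they come
    after A, every a in A satisfies a -> x in the limit. Hence in a small
    3-cycle x -> b -> c -> x the point b is outside A (as x -> b) and after A;
    then c is outside A too (as b -> c) and before A (as c -> x). So points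
    before A also accumulate at x, whence x -> a, and a = x. The other case is
    the mirror image. *)
Lemma module_boundary A x : module A -> A x -> cycle_point x -> ~ nbhs x A ->
  A `<=` [set x].
Proof.
move=> mA Ax cx nA a Aa.
have [src|] := pselect (forall U, nbhs x U -> exists2 z, U z /\ ~ A z & tr X (x, z)).
  have ax b : A b -> tr X (b, x).
    move=> Ab; apply: (tr_cluster_r ctX) => U /src[z [Uz nz] xz].
    by exists z => //; exact: (module_to mA nz Ax).
  apply/(tr_anti ctX); first exact: ax.
  apply: (tr_cluster_l ctX) => U nU.
  have [b [c [[Ub Uc [xb bc cx']] [txb tbc tcx]]]] := cycle_pointE cx nU.
  have nAb : ~ A b by move=> /ax /(tr_anti ctX txb).
  have nAc : ~ A c.
    by move=> Ac; apply: bc; apply: (tr_anti ctX) => //; exact: (module_to mA nAb Ax).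
  by exists c => //; exact: (module_from mA nAc Ax).
move=> /existsNP[V /not_implyP[nV nsrc]].
have tgt U : nbhs x U -> exists2 z, U z /\ ~ A z & tr X (z, x).
  move=> nU; have [z [Uz Vz] nz] := not_nbhsP nA (filterI nU nV).
  exists z => //; have [//|xz] := tr_total ctX z x.
  by case: nsrc; exists z.
have xa b : A b -> tr X (x, b).
  move=> Ab; apply: (tr_cluster_l ctX) => U /tgt[z [Uz nz] xz].
  by exists z => //; exact: (module_from mA nz Ax).
apply/(tr_anti ctX); last exact: xa.
apply: (tr_cluster_r ctX) => U nU.
have [b [c [[Ub Uc [xb bc cx']] [txb tbc tcx]]]] := cycle_pointE cx nU.
have nAc : ~ A c by move=> /xa /(tr_anti ctX tcx).
have nAb : ~ A b.
  by move=> Ab; apply: bc; apply: (tr_anti ctX) => //; exact: (module_from mA nAc Ax).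
by exists b => //; exact: (module_to mA nAb Ax).
Qed.

End Modules.

Section WacModules.
Variables (X : relSpace) (wacX : wac_tournament X).
Implicit Types (x y z a b c w : X) (A B U : set X).

Lemma wac_ct : ct_tournament X. Proof. by case: wacX. Qed.
Hint Resolve wac_ct : core.

Lemma wac_cycle x : ~ open [set x] -> cycle_point x.
Proof. by move=> nx; apply: wacX.2 => /isolated_setTP. Qed.

Lemma wac_module_open A x y : module A -> A x -> A y -> x <> y -> open A.
Proof.
move=> mA Ax Ay xy; apply: openP_nbhs => z Az.
have [oz|/wac_cycle cz] := pselect (open [set z]).
  by apply: (@filterS _ _ _ [set z]) => [_ ->//|]; exact: open_nbhs_nbhs.
apply: contrapT => /(module_boundary wac_ct mA Az cz) sA.
by apply: xy; rewrite (sA _ Ax) (sA _ Ay).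
Qed.

(** The closure of A is again a module, hence open. A point z of the closure
    outside A is comparable in one direction with all of A, hence with its own
    neighbourhood [closure A]: no 3-cycle through z fits in there. *)
Lemma wac_module_clopen A x y : module A -> A x -> A y -> x <> y -> clopen A.
Proof.
move=> mA Ax Ay xy; split; first exact: (wac_module_open mA Ax Ay xy).
have mcA := module_closure wac_ct mA.
have ocA : open (closure A).
  by apply: (wac_module_open mcA _ _ xy); exact: subset_closure.
move=> z clz; apply: contrapT => nAz.
have nz : nbhs z (closure A) by exact: open_nbhs_nbhs.
have cz : cycle_point z.
  apply: wac_cycle => oz; have [|t [At /= tz]] := clz [set z].
    exact: open_nbhs_nbhs.
  by apply: nAz; rewrite -tz.
have [zA|Az] := mA _ nAz.
  apply: (cycle_point_not_source wac_ct cz nz) => a cla.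
  by apply: (tr_cluster_r wac_ct) => U /cla[u [Au Uu]]; exists u => //; exact: zA.
apply: (cycle_point_not_target wac_ct cz nz) => a cla.
by apply: (tr_cluster_l wac_ct) => U /cla[u [Au Uu]]; exists u => //; exact: Az.
Qed.

Lemma wac_module_cases A x : module A -> A x -> A = [set x] \/ clopen A.
Proof.
move=> mA Ax; have [sA|] := pselect (A `<=` [set x]).
  by left; rewrite eqEsubset; split => // _ ->.
by move=> /existsNP[y /not_implyP[Ay yx]]; right; exact: (wac_module_clopen mA Ay Ax).
Qed.

Lemma wac_module_closed A x : module A -> A x -> closed A.
Proof.
move=> mA Ax; have [->|[]//] := wac_module_cases mA Ax.
exact: ct_closed1.
Qed.

End WacModules.

(** * Collapsing a partition into modules *)

Section ModuleQuotient.
Variables (X : relSpace) (wacX : wac_tournament X) (E : X -> X -> Prop).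
Hypotheses (Exx : forall x, E x x) (Esym : forall x y, E x y -> E y x)
  (Etrans : forall x y z, E x y -> E y z -> E x z)
  (Emod : forall x, module [set y | E x y]).
Local Notation cls x := [set y | E x y].
Let ctX := wac_ct wacX.

(** The relation between two distinct classes does not depend on the
    representatives, by moving one end at a time. *)
Lemma classes_tr x y x' y' : ~ E x y -> E x x' -> E y y' ->
  tr X (x, y) -> tr X (x', y').
Proof.
move=> nxy xx' yy' xy.
have xy' : tr X (x, y').
  by apply: (@module_from _ ctX _ x y y' (@Emod y)) => //= /Esym.
apply: (@module_to _ ctX _ y' x x' (@Emod x)) => //= xEy'.
by apply: nxy; apply: Etrans xEy' (Esym yy').
Qed.

Let saturated (V : set X) := forall x y, E x y -> V x -> V y.

Lemma class_sep_clopen a b : ~ E a b -> open (cls a) ->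
  exists V W, [/\ open V /\ saturated V, open W /\ saturated W,
    V a, W b & V `&` W = set0].
Proof.
move=> nab oa; exists (cls a), (~` cls a); split => //.
- by split => // x y xy /= ax; exact: Etrans xy.
- split; first exact/closed_openC/(wac_module_closed wacX (@Emod a) (Exx a)).
  by move=> x y xy /= ax ay; apply: ax; exact: Etrans ay (Esym xy).
- by rewrite setICr.
Qed.

(** An open class is clopen and saturated, so it separates. If neither class
    is open, both are singletons, and {a, b} is not a module since a module with
    two points is open. So some c lies between a and b for the relation, and the
    points after c and the points before c, outside the class of c, are disjoint
    saturated open sets. *)
Lemma class_sep a b : ~ E a b ->
  exists V W, [/\ open V /\ saturated V, open W /\ saturated W,
    V a, W b & V `&` W = set0].
Proof.
move=> nab.
have [oa|na] := pselect (open (cls a)); first exact: class_sep_clopen.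
have [ob|nb] := pselect (open (cls b)).
  have [|W [V [? ? ? ? VW]]] := class_sep_clopen _ ob (b := a).
    by move=> /Esym.
  by exists V, W; rewrite setIC.
have sing c : ~ open (cls c) -> cls c = [set c].
  by move=> nc; case: (wac_module_cases wacX (@Emod c) (Exx c)) => [//|[]].
have ab : a <> b by move=> ab; apply: nab; rewrite ab.
(* otherwise {a, b} is open, and so is {a}, since {b} is closed *)
have nmod : ~ module [set a; b].
  move=> mab; apply: (na); rewrite sing //.
  have -> : [set a] = [set a; b] `&` ~` [set b].
    rewrite predeqE => x; split=> [->|[[|] -> //]]; last by case.
    by split => //; left.
  apply: openI; first by apply: (wac_module_open wacX mab _ _ ab); [left|right].
  exact/closed_openC/(ct_closed1 ctX).
have [c /not_implyP[nc /not_orP[cab abc]]] := (existsNP _).2 nmod.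
have nEc d : [set a; b] d -> ~ E c d.
  move=> abd /Esym dc; apply: nc; suff <- : d = c by [].
  have : cls d c by [].
  by case: abd => ->; rewrite sing // => ->.
have nEca := nEc a (or_introl erefl); have nEcb := nEc b (or_intror erefl).
pose V := [set u | ~ E c u /\ ~ tr X (u, c)].
pose W := [set u | ~ E c u /\ ~ tr X (c, u)].
have ocls : open (~` cls c).
  exact/closed_openC/(wac_module_closed wacX (@Emod c) (Exx c)).
have oV : open V /\ saturated V.
  split; first by apply: openI => //; exact/closed_openC/closed_tr_to.
  move=> u v uv [ncu nuc]; split=> [cv|vc].
    by apply: ncu; apply: Etrans cv (Esym uv).
  apply: nuc; apply: classes_tr vc => //; last exact: Esym.
  by move=> vEc; apply: ncu; exact: Esym (Etrans uv vEc).
have oW : open W /\ saturated W.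
  split; first by apply: openI => //; exact/closed_openC/closed_tr_from.
  move=> u v uv [ncu nuc]; split=> [cv|vc].
    by apply: ncu; apply: Etrans cv (Esym uv).
  apply: nuc; apply: classes_tr vc => //; last exact: Esym.
  by move=> cEv; apply: ncu; exact: Etrans cEv (Esym uv).
have VW : V `&` W = set0.
  rewrite -subset0 => u [[_ nuc] [_ ncu]].
  by have [] := tr_total ctX u c.
have [ca|nca] := pselect (tr X (c, a)).
  have Va : V a by split=> // ac; apply: nEca; rewrite (tr_anti ctX ac ca).
  have Wb : W b.
    split => // cb; apply: cab => d [] -> //.
  by exists V, W.
have Wa : W a by split.
have ac : tr X (a, c) by have [] := tr_total ctX a c.
have Vb : V b by split=> // bc; apply: abc => d [] -> //.
by exists W, V; rewrite setIC.
Qed.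

Let e : rel X := fun x y => `[< E x y >].
Let e_equiv : equiv_class_of e.
Proof.
split=> [x|x y|y x z].
- exact/asboolP.
- by apply/asboolP/asboolP => /Esym.
- by move=> /asboolP xy /asboolP yz; apply/asboolP; exact: Etrans yz.
Qed.
Let eE : equiv_rel X := EquivRelPack e_equiv.
Let Q := quotient_topology {eq_quot eE}%qT.
Let pi : X -> Q := \pi_({eq_quot eE})%qT.

Let piP x x' : pi x = pi x' <-> E x x'.
Proof.
split=> [e_xx'|xx']; first by apply/asboolP; exact: (introT (@eqmodP _ eE x x') e_xx').
by apply: (elimT (@eqmodP _ eE x x')); exact/asboolP.
Qed.

Let piS (y : Q) : exists x, pi x = y.
Proof. by exists (repr (y : {eq_quot eE}%qT)); rewrite /pi reprK. Qed.

(** The quotient space is Hausdorff by [class_sep], and its relation is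
    antisymmetric by [classes_tr]; compactness takes care of the rest. *)
Lemma module_quotient_exists :
  exists (Y : relSpace) (h : X -> Y), quotient_map h /\
    forall x x', h x = h x' <-> E x x'.
Proof.
pose Y := @RelSpace Q [set p | exists x x', tr X (x, x') /\ p = (pi x, pi x')].
exists Y, pi; split; last exact: piP.
apply: quotient_mapI => //.
- move=> y z; apply: contraPP => /= yz.
  have [a ay] := piS y; have [b bz] := piS z.
  have nab : ~ E a b by move=> /piP; rewrite ay bz.
  have [V [W [[oV sV] [oW sW] Va Wb VW]]] := class_sep nab.
  have im U : open U -> saturated U -> open (pi @` U : set Y).
    move=> oU sU; rewrite /open /= /quotient_open.
    suff -> : \pi_Q%qT @^-1` (pi @` U) = U by [].
    rewrite predeqE => x; split=> [[x' Ux' /piP]|Ux]; last by exists x.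
    by move/sU; exact.
  move=> cl; have [||t [[v Vv vt] [w Ww wt]]] := cl (pi @` V) (pi @` W).
  - by apply: (@open_nbhs_nbhs Y); split; [exact: im|exists a].
  - by apply: (@open_nbhs_nbhs Y); split; [exact: im|exists b].
  have /sV/(_ Vv) Vw : E v w by apply/piP; rewrite vt wt.
  by have : (V `&` W) w by []; rewrite VW.
- move=> y y' [x1 [x1' [t1 [e1 e1']]]] [x2' [x2 [t2 [e2' e2]]]].
  apply: contrapT => yy'.
  have n1 : ~ E x1 x1' by move=> /piP; rewrite -e1 -e1'.
  have t3 : tr X (x2, x2').
    by apply: classes_tr t1 => //; apply/piP; [rewrite -e1|rewrite -e1'].
  by apply: yy'; rewrite e2 e2' (tr_anti ctX t2 t3).
- by move=> y _; have [x <-] := piS y; exists x.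
- exact: pi_continuous.
- by move=> x x' xx'; exists x, x'.
Qed.

End ModuleQuotient.

(** * Restrictions *)

Section Restriction.
Variables (X : relSpace) (A : set X).

Lemma restr_valP (z : restr A) : A (set_val z).
Proof. exact: set_valP. Qed.

Lemma restr_ex x : A x -> exists z : restr A, set_val z = x.
Proof. by move=> Ax; exists (exist _ x (mem_set Ax)). Qed.

Lemma restr_inj (z z' : restr A) : set_val z = set_val z' -> z = z'.
Proof. exact: val_inj. Qed.

Lemma restr_continuous : continuous (set_val : restr A -> X).
Proof. exact: initial_continuous. Qed.

Lemma restr_open (V : set (restr A)) : open V ->
  exists2 U, open U & set_val @^-1` U = V.
Proof. by case=> U oU <-; exists U. Qed.

Lemma continuous_to_restr (Y : topologicalType) (g : Y -> restr A) :
  continuous (fun y => set_val (g y)) -> continuous g.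
Proof.
move=> /continuousP cg; apply/continuousP => V /restr_open[U oU <-].
exact: cg U oU.
Qed.

Lemma restr_hausdorff : hausdorff_space X -> hausdorff_space (restr A).
Proof.
move=> hX x y cl; apply: restr_inj; apply: hX => U V nU nV.
have [t [? ?]] := cl _ _ (restr_continuous nU) (restr_continuous nV).
by exists (set_val t).
Qed.

Lemma restr_ct : ct_tournament X -> A !=set0 -> closed A ->
  ct_tournament (restr A).
Proof.
move=> ctX [x Ax] cA; split.
- exact/restr_hausdorff/ct_hausdorff.
- move=> F FF _; have FA : F (set_val @^-1` A).
    by apply: filterE => z; exact: restr_valP.
  have cptA : compact A by apply: (subclosed_compact cA (ct_compact ctX)).
  have [y [Ay cly]] := cptA (set_val @ F) _ FA.
  have [z zy] := restr_ex Ay; exists z; split => // B V FB nV.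
  move: nV; rewrite nbhsE => -[W [/restr_open[U oU <-] Uz] sWV].
  have [||t [[s Bs st] Ut]] := cly (set_val @` B) U.
  + by rewrite /fmap /=; apply: (@filterS _ F _ _ _ _ FB) => s Bs; exists s.
  + by apply: open_nbhs_nbhs; rewrite -zy.
  by exists s; split => //; apply: sWV; rewrite /= st.
- split.
  + by have [z _] := restr_ex Ax; exists z.
  + rewrite predeqE => -[z z']; split=> [[/= zz' z'z]|/diagonalP /= <-].
      by apply/diagonalP/restr_inj; exact: (tr_anti ctX).
    by split; exact: (tr_refl ctX).
  + rewrite predeqE => -[z z']; split => // _.
    exact: (tr_total ctX).
- have c2 : continuous (fun p : restr A * restr A => (set_val p.1, set_val p.2)).
    move=> p; apply: cvg_pair => /=.
      by apply: continuous_comp; [exact: cvg_fst|exact: restr_continuous].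
    by apply: continuous_comp; [exact: cvg_snd|exact: restr_continuous].
  by move/continuous_closedP: c2; apply; case: ctX.
Qed.

End Restriction.

(** A module is a singleton, which is a trivial tournament, or it is open, and
    then small cycles through its points stay inside. *)
Lemma restr_wac (X : relSpace) (A : set X) : wac_tournament X -> module A ->
  A !=set0 -> wac_tournament (restr A).
Proof.
move=> wacX mA [x0 Ax0]; have ctX := wac_ct wacX.
have cA := wac_module_closed wacX mA Ax0.
split=> [|x nx]; first by apply: restr_ct => //; exists x0.
have nx1 : ~ open [set x] by move=> /isolated_setTP.
have Ax := restr_valP x.
have [A1|[oA _]] := wac_module_cases wacX mA Ax.
  case: nx1; suff -> : [set x] = [set: restr A] by exact: openT.
  rewrite eqEsubset; split => // y _; apply: restr_inj.
  have sA : A `<=` [set set_val x] by rewrite -A1.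
  by apply: sA; exact: restr_valP.
have cx : cycle_point (set_val x).
  apply: (wac_cycle wacX) => ox; apply: nx1.
  have -> : [set x] = set_val @^-1` [set set_val x].
    by rewrite predeqE => y; split=> [->//|/restr_inj].
  by move/continuousP: (@restr_continuous _ A) => /(_ _ ox).
move=> V; rewrite nbhsE => -[W [/restr_open[U oU <-] Ux] sWV].
have [|b [c [[[Ub Ab] [Uc Ac] [xb bc cx']] [txb tbc tcx]]]] :=
    @cycle_pointE _ _ (U `&` A) cx.
  by apply: filterI; apply: open_nbhs_nbhs; split.
have [b' eb] := restr_ex Ab; have [c' ec] := restr_ex Ac; subst b c.
have nb : x <> b' by move=> e; apply: xb; rewrite e.
have nc : b' <> c' by move=> e; apply: bc; rewrite e.
have nx' : c' <> x by move=> e; apply: cx'; rewrite e.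
exists x, b', c'; split; last by left; left.
  by split; split => //; split => // /diagonalP.
by move=> t [[->|->]|->]; exact: sWV.
Qed.

(** * Cuts and arc quotients *)

(** The initial parts of the quotient maps onto an arc. *)
Definition cut (X : relSpace) (A : set X) : Prop :=
  [/\ clopen A, A !=set0, ~` A !=set0 &
      forall a b, A a -> ~ A b -> tr X (a, b)].

Section Cuts.
Variables (X : relSpace) (ctX : ct_tournament X).

Lemma cut_arc_quotient (A : set X) : cut A -> has_arc_quotient X.
Proof.
move=> [[oA cA] [a Aa] [b nAb] AB].
pose Y := @RelSpace bool [set p | p.1 ==> p.2].
pose h : X -> Y := fun x => `[< ~ A x >].
exists Y, h; split.
  by exists true, false; split => //; rewrite eqEsubset; split => // -[] _; [left|right].
apply: quotient_mapI => //.
- exact: discrete_hausdorff.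
- by case=> [] [].
- move=> [] _; [exists b => //|exists a => //]; first exact/asboolP.
  by apply/asboolP => /(_ Aa).
- apply/continuousP => V _.
  have -> : h @^-1` V = (A `&` [set _ | V false]) `|` (~` A `&` [set _ | V true]).
    rewrite predeqE => x; rewrite /preimage /= /h; have [Ax|nAx] := pselect (A x).
      have -> : `[< ~ A x >] = false by apply/asboolP => /(_ Ax).
      by split; [left|case=> [[]|[]]].
    have -> : `[< ~ A x >] = true by apply/asboolP.
    by split; [right|case=> [[]|[]]].
  have oc (P : Prop) : open [set _ : X | P].
    have [p|np] := pselect P.
      by rewrite (_ : [set _ | P] = setT) ?predeqE //; exact: openT.
    by rewrite (_ : [set _ | P] = set0) ?predeqE //; exact: open0.
  by apply: openU; apply: openI => //; exact: closed_openC.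
- move=> x x' xx'; rewrite /= /h; apply/implyP => /asboolP nAx; apply/asboolP => Ax'.
  by have e := tr_anti ctX xx' (AB _ _ Ax' nAx); apply: nAx; rewrite e.
Qed.

Lemma arc_quotient_cut : has_arc_quotient X -> exists A : set X, cut A.
Proof.
move=> [Y [h [[y1 [y2 [y12 YE]]] qh]]].
wlog ty : y1 y2 y12 YE / tr Y (y1, y2).
  move=> wl; have [ty|ty] := tr_total (qm_cod qh) y1 y2; first exact: (wl y1 y2).
  by apply: (wl y2 y1) => //; [exact: nesym|rewrite setUC].
have YC x : h x <> y1 -> h x = y2.
  by move=> hx; have : [set: Y] (h x) by []; rewrite YE => -[].
have C1 : h @^-1` [set y1] = ~` (h @^-1` [set y2]).
  rewrite predeqE => x; split=> /= [->//|hx].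
  by apply: contrapT => /YC.
exists (h @^-1` [set y1]); split.
- split; last exact: (qm_closed_fibre qh).
  by rewrite C1; exact/closed_openC/(qm_closed_fibre qh).
- by have [x <-] := qm_surj qh y1; exists x.
- have [x hx] := qm_surj qh y2; exists x => /= hx1.
  by apply: y12; rewrite -hx -hx1.
- move=> a b /= ha /YC hb; apply: (qm_lift qh); rewrite ha hb //.
Qed.


End Cuts.

Lemma cut_restr_arc_quotient (X : relSpace) (A C : set X) (x y : X) :
  ct_tournament X -> closed A -> cut C ->
  A x -> A y -> C x -> ~ C y -> has_arc_quotient (restr A).
Proof.
move=> ctX cA [[oC cC] _ _ CC] Ax Ay Cx Cy.
have ctA : ct_tournament (restr A) by apply: restr_ct => //; exists x.
apply: (@cut_arc_quotient _ ctA (set_val @^-1` C)); split.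
- by apply: preimage_clopen => //; exact: restr_continuous.
- by have [z zx] := restr_ex Ax; exists z; rewrite /= zx.
- by have [z zy] := restr_ex Ay; exists z; rewrite /= zy.
- by move=> a b Ca Cb; exact: CC.
Qed.

(** * Maximum order quotient maps *)

Definition uncut (X : relSpace) (x y : X) : Prop :=
  forall A : set X, cut A -> (A x <-> A y).

Section MaximumOrder.
Variables (X : relSpace) (wacX : wac_tournament X).
Let ctX := wac_ct wacX.

Lemma uncut_refl (x : X) : uncut x x. Proof. by []. Qed.
Lemma uncut_sym (x y : X) : uncut x y -> uncut y x.
Proof. by move=> xy A cA; apply: iff_sym; exact: xy. Qed.
Lemma uncut_trans (x y z : X) : uncut x y -> uncut y z -> uncut x z.
Proof. by move=> xy yz A cA; apply: (iff_trans (xy A cA)); exact: yz. Qed.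

Lemma uncut_module (x : X) : module [set y | uncut x y].
Proof.
move=> w /= /existsNP[A /not_implyP[cA nxw]].
have [Ax|nAx] := pselect (A x); [right|left] => y xy.
  have nAw : ~ A w by move=> Aw; apply: nxw.
  by case: cA (xy A cA) => _ _ _ Ato [xy' _]; apply: Ato => //; exact: xy'.
have Aw : A w by apply: contrapT => nAw; apply: nxw.
by case: cA (xy A cA) => _ _ _ Ato [_ yx']; apply: Ato => // /yx'.
Qed.

(** A cut is crossed in one direction only, so no cycle crosses it. *)
Lemma three_cycle_uncut (a b c : X) : b <> c ->
  tr X (a, b) -> tr X (b, c) -> tr X (c, a) -> uncut a b.
Proof.
move=> bc ab tbc ca A [_ _ _ Ato]; split=> [Aa|Ab]; apply: contrapT => nA.
- have [Ac|nAc] := pselect (A c).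
    by apply: bc; apply: (tr_anti ctX) => //; exact: Ato.
  by apply: (nAc); rewrite (tr_anti ctX ca (Ato _ _ Aa nAc)).
- by apply: (nA); rewrite (tr_anti ctX ab (Ato _ _ Ab nA)).
Qed.

(** The class of a point that is not isolated contains a 3-cycle through it,
    hence is a module with several points. *)
Lemma uncut_class_open (x : X) : open [set y | uncut x y].
Proof.
have [ox|/(wac_cycle wacX) cx] := pselect (open [set x]).
  have [e|[]//] := wac_module_cases wacX (@uncut_module x) (@uncut_refl x).
  by rewrite e.
have [b [c [[_ _ [xb bc _]] [txb tbc tcx]]]] := cycle_pointE cx filterT.
apply: (wac_module_open wacX (@uncut_module x) (@uncut_refl x) _ xb).
exact: three_cycle_uncut bc txb tbc tcx.
Qed.

(** A cut [B] of the class of [x] would extend to a cut of [X] separating two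
    points of that class: add to it the points before the class, which are
    closed downwards as the quotient [Y] is an order. *)
Lemma uncut_class_no_cut (Y : relSpace) (h : X -> Y) (x : X)
    (B : set (restr [set y | uncut x y])) :
  quotient_map h -> is_order Y -> (forall x x', h x = h x' <-> uncut x x') ->
  cut B -> False.
Proof.
move=> qh [ctY trY] hE [[oB cB] [b Bb] [d nBd] Bto].
pose E := [set y | uncut x y].
have oE : open E := uncut_class_open x.
have cE : closed E := wac_module_closed wacX (@uncut_module x) (@uncut_refl x).
have mE : module E := @uncut_module x.
have Ex : E x := @uncut_refl x.
pose B' := set_val @` B : set X.
pose P := [set z | ~ E z /\ tr X (z, x)].
have PE : P = [set z | ~ E z /\ ~ tr X (x, z)].
  rewrite predeqE => z; split=> -[nEz zx]; split => //.
    by move=> xz; apply: nEz; rewrite (tr_anti ctX zx xz).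
  by have [] := tr_total ctX z x.
have oP : open P.
  rewrite PE; apply: openI; first exact: closed_openC.
  exact/closed_openC/closed_tr_from.
have cP : closed P.
  apply: closedI; first exact: open_closedC.
  exact: closed_tr_to.
have oB' : open B'.
  have [U oU UB] := restr_open oB.
  suff -> : B' = U `&` E by exact: openI.
  rewrite predeqE => z; split=> [[t Bt <-]|[Uz Ez]].
    by split; [move: Bt; rewrite -UB|exact: restr_valP].
  by have [t tz] := restr_ex Ez; exists t => //; rewrite -UB /= tz.
have cB' : closed B'.
  have [U oU UB] := restr_open (closed_openC cB).
  suff -> : B' = ~` U `&` E by apply: closedI => //; exact: open_closedC.
  rewrite predeqE => z; split=> [[t Bt <-]|[Uz Ez]].
    split; last exact: restr_valP.
    move=> Ut; have : (~` B) t by rewrite -UB.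
    exact.
  have [t tz] := restr_ex Ez; exists t => //; apply: contrapT => nBt.
  by apply: Uz; have : (~` B) t by []; rewrite -UB /= tz.
have cutC : cut (B' `|` P).
  split.
  - by split; [exact: openU|exact: closedU].
  - by exists (set_val b); left; exists b.
  - exists (set_val d); move=> [[t Bt /restr_inj td]|[nE _]].
      by apply: nBd; rewrite -td.
    by apply: nE; exact: restr_valP.
  - move=> y z BPy /not_orP[nBz nPz].
    have [Ez|nEz] := pselect (E z).
      case: BPy => [[t Bt ty]|[nEy yx]]; last exact: (module_from ctX mE nEy Ex Ez).
      have [s sz] := restr_ex Ez; rewrite -ty -sz; apply: Bto => // Bs.
      by apply: nBz; exists s.
    have xz : tr X (x, z) by have [//|zx] := tr_total ctX x z; case: nPz.
    case: BPy => [[t Bt ty]|[nEy yx]].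
      by apply: (module_to ctX mE nEz Ex) => //; rewrite -ty; exact: restr_valP.
    apply: (qm_lift qh); last by apply: trY (qm_tr qh yx) (qm_tr qh xz).
    move=> yz; apply: nEz; apply/hE; apply: (tr_anti ctY); first exact: (qm_tr qh).
    by rewrite -yz; exact: (qm_tr qh).
have xb : E (set_val b) := restr_valP b.
have xd : E (set_val d) := restr_valP d.
have [+ _] := uncut_trans (uncut_sym xb) xd cutC.
case; first by left; exists b.
  by move=> [t Bt /restr_inj td]; apply: nBd; rewrite -td.
by case=> + _; apply; exact: restr_valP.
Qed.

(** The classes of [uncut] are open, so the quotient by them is finite by
    compactness; it is transitive because the three points of a 3-cycle lie in
    one class. *)
Lemma maximum_order_quotient_exists : has_arc_quotient X ->
  exists (Y : relSpace) (h : X -> Y), maximum_order_quotient_map h.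
Proof.
move=> /(arc_quotient_cut)[C cutC].
have [Y [h [qh hE]]] := module_quotient_exists wacX uncut_refl uncut_sym
  uncut_trans uncut_module.
have ctY := qm_cod qh.
have orderY : is_order Y.
  split => // y1 y2 y3; have [x1 <-] := qm_surj qh y1; have [x2 <-] := qm_surj qh y2.
  have [x3 <-] := qm_surj qh y3; move=> t12 t23; apply: contrapT => n13.
  have n12 : h x1 <> h x2 by move=> e; apply: n13; rewrite e.
  have n23 : h x2 <> h x3 by move=> e; apply: n13; rewrite -e.
  have n31 : h x3 <> h x1 by move=> e; apply: n13; rewrite e; exact: (tr_refl ctY).
  have t31 : tr Y (h x3, h x1) by have [] := tr_total ctY (h x3) (h x1).
  apply: (n12); apply/hE; apply: (@three_cycle_uncut _ _ x3).
  - by move=> e; apply: n23; rewrite e.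
  - exact: (qm_lift qh).
  - exact: (qm_lift qh).
  - exact: (qm_lift qh).
exists Y, h; split => //; last first.
  move=> y; have [x hx] := qm_surj qh y.
  have -> : h @^-1` [set y] = [set z | uncut x z].
    rewrite predeqE => z; split=> /= [hz|/hE <-//].
    by apply/hE; rewrite hx hz.
  by move=> /(arc_quotient_cut)[B]; exact: (uncut_class_no_cut qh orderY hE).
split => //; last first.
  move=> [y Yy]; have [_ [a Ca] [b nCb] _] := cutC; apply: nCb.
  have ab : uncut a b.
    apply/hE; have : [set: Y] (h a) by []; have : [set: Y] (h b) by [].
    by rewrite Yy => /= -> ->.
  exact: (ab C cutC).1.
(* open sets with finite image are stable under finite unions *)
have fin : [set U : set X | open U /\ finite_set (h @` U)] setT.
  apply: (compact_directed_cover (ct_compact ctX)).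
  - by exists set0; split; [exact: open0|rewrite image_set0].
  - by move=> A [].
  - move=> A B [oA fA] [oB fB]; exists (A `|` B) => //; split; first exact: openU.
    by rewrite image_setU finite_setU.
  - move=> x; exists [set z | uncut x z] => //; split; first exact: uncut_class_open.
    apply: (@sub_finite_set _ _ [set h x]) => // _ [z /= xz <-].
    exact/esym/hE.
have -> : [set: Y] = h @` setT.
  by rewrite eqEsubset; split => // y _; have [x <-] := qm_surj qh y; exists x.
by case: fin.
Qed.

(** In a finite order the points up to [h x] form a cut. *)
Lemma maximum_order_cut (Y : relSpace) (h : X -> Y) (x x' : X) :
  maximum_order_quotient_map h -> h x <> h x' -> tr Y (h x, h x') ->
  exists A : set X, [/\ cut A, A x & ~ A x'].
Proof.
move=> [qh [[ctY trY] finY _] _] nxx' txx'.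
have Ycl (D : set Y) : closed D.
  have /accessible_finite_set_closed := hausdorff_accessible (ct_hausdorff ctY).
  by apply; apply: sub_finite_set finY.
pose D := [set y | tr Y (y, h x)].
have Dx : D (h x) := tr_refl ctY _.
have nDx' : ~ D (h x') by move=> x'x; apply: nxx'; exact: (tr_anti ctY).
exists (h @^-1` D); split => //; split.
- by apply: preimage_clopen; [split => //; rewrite -closedC|exact: (qm_cont qh)].
- by exists x.
- by exists x'.
- move=> a b /= Da nDb; apply: (qm_lift qh).
    by move=> e; apply: nDb; rewrite /D /= -e.
  apply: trY Da _; by have [] := tr_total ctY (h x) (h b).
Qed.

(** A cut of [X] cannot separate two points of a fibre, since it would cut the
    fibre, which has no arc quotient. *)
Lemma maximum_order_kernel (Y : relSpace) (h : X -> Y) (x x' : X) :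
  maximum_order_quotient_map h -> (h x = h x' <-> uncut x x').
Proof.
move=> mh; have [qh _ noarc] := mh; split=> [e A cA|xx'].
  have cf := qm_closed_fibre qh (y := h x').
  have sep u v : h u = h x' -> h v = h x' -> A u -> A v.
    move=> hu hv Au; apply: contrapT => nAv; apply: (noarc (h x')).
    exact: (cut_restr_arc_quotient ctX cf cA hu hv Au nAv).
  by split; exact: sep.
apply: contrapT => nxx'.
have [t|t] := tr_total (qm_cod qh) (h x) (h x').
  by have [A [cA Ax nAx']] := maximum_order_cut mh nxx' t; apply/nAx'/(xx' A cA).
have [|A [cA Ax' nAx]] := maximum_order_cut mh _ t; first exact: nesym.
by apply/nAx/(xx' A cA).
Qed.

End MaximumOrder.

(** * Prime quotient maps *)

Lemma not_trivialP (X : relSpace) (x : X) :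
  ~ trivial_tournament X <-> exists y : X, x <> y.
Proof.
split=> [nt|[y xy] [z Xz]].
  apply: contrapT => nE; apply: nt; exists x; rewrite eqEsubset; split => // y _ /=.
  by apply: contrapT => xy; apply: nE; exists y; apply: nesym.
have : [set: X] x by []; have : [set: X] y by [].
by rewrite Xz /= => yz xz; apply: xy; rewrite yz xz.
Qed.

Lemma fibre_proper (X Y : relSpace) (h : X -> Y) (y : Y) :
  quotient_map h -> ~ trivial_tournament Y -> h @^-1` [set y] <> setT.
Proof.
move=> qh /(not_trivialP y)[y' yy'] hT; have [x hx] := qm_surj qh y'.
have : (h @^-1` [set y]) x by rewrite hT.
by rewrite /= hx => /esym.
Qed.

(** The kernel of the prime quotient map of a nontrivial tournament without arc
    quotient ([prime_kernel]). *)
Definition cohabit (X : relSpace) (x y : X) : Prop :=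
  x = y \/ exists A : set X, [/\ module A, A <> setT, A x & A y].

Section Prime.
Variables (X : relSpace) (wacX : wac_tournament X).
Hypotheses (noarc : ~ has_arc_quotient X) (ntX : ~ trivial_tournament X).
Let ctX := wac_ct wacX.

(** Suppose A and B cover X, with b in A outside B. If b comes before B, then
    A, which contains b, comes before its complement, a part of B; so A is a
    cut. If b comes after B, the complement of A is a cut. *)
Lemma proper_module_setU (A B : set X) (c : X) : module A -> module B ->
  A <> setT -> B <> setT -> A c -> B c -> A `|` B <> setT.
Proof.
move=> mA mB nA nB Ac Bc ABT; apply: noarc.
have /existsNP[a nAa] : ~ forall a, A a.
  by move=> AT; apply: nA; rewrite eqEsubset; split => // x _.
have /existsNP[b nBb] : ~ forall b, B b.
  by move=> BT; apply: nB; rewrite eqEsubset; split => // x _.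
have AB x : ~ A x -> B x.
  by move=> nAx; have : [set: X] x by []; rewrite -ABT => -[].
have Ab : A b.
  by apply: contrapT => /AB.
have bc : b <> c by move=> bc; apply: nBb; rewrite bc.
have clA : clopen A := wac_module_clopen wacX mA Ab Ac bc.
have [bB|Bb] := mB _ nBb.
  apply: (cut_arc_quotient ctX (A := A)); split=> //; first by exists b.
    by exists a.
  move=> u v Au nAv.
  by apply: (module_to ctX mA nAv Ab Au); exact/bB/AB.
apply: (cut_arc_quotient ctX (A := ~` A)); split.
- exact: clopenC.
- by exists a.
- by exists b; rewrite setCK.
- move=> u v nAu /contrapT Av.
  by apply: (module_from ctX mA nAu Ab Av); exact/Bb/AB.
Qed.

Lemma cohabit_refl (x : X) : cohabit x x. Proof. by left. Qed.

Lemma cohabit_sym (x y : X) : cohabit x y -> cohabit y x.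
Proof. by case=> [->|[A [? ? ? ?]]]; [left|right; exists A]. Qed.

Lemma cohabit_trans (x y z : X) : cohabit x y -> cohabit y z -> cohabit x z.
Proof.
case=> [->//|[A [mA nA Ax Ay]]] [<-|[B [mB nB By Bz]]]; right; first by exists A.
exists (A `|` B); split; [|exact: (proper_module_setU mA mB nA nB Ay By)|by left|by right].
exact: (module_setU ctX mA mB Ay By).
Qed.

(** An outside point has the same relation to [x] and to any proper module
    through [x]. *)
Lemma cohabit_module (x : X) : module [set y | cohabit x y].
Proof.
move=> w nw; have [wx|xw] := tr_total ctX w x; [left|right] => y [<-//|[A [mA nA Ax Ay]]].
  by apply: (module_from ctX mA _ Ax) => // Aw; apply: nw; right; exists A.
by apply: (module_to ctX mA _ Ax) => // Aw; apply: nw; right; exists A.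
Qed.

Lemma fibre_cohabit (Y : relSpace) (h : X -> Y) (x x' : X) :
  quotient_map h -> ~ trivial_tournament Y -> h x = h x' -> cohabit x x'.
Proof.
move=> qh ntY e; right; exists (h @^-1` [set h x]); split => //.
  exact: module_fibre.
exact: fibre_proper.
Qed.

(** The proper modules with at least two points that contain [x] are open, and
    the union of two of them is again proper; by compactness they do not
    cover. *)
Lemma cohabit_class_proper (x : X) : [set y | cohabit x y] <> setT.
Proof.
move=> xT; have [x0 xx0] := (not_trivialP x).1 ntX.
have xP z : x <> z -> exists A : set X, [/\ module A, A <> setT, A x & A z].
  by move=> xz; have : [set y | cohabit x y] z; [rewrite xT|case].
pose P := [set A : set X | [/\ module A, A <> setT, A x & exists2 z, A z & x <> z]].
suff : P setT by case.
apply: (compact_directed_cover (ct_compact ctX)).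
- by have [A [mA nA Ax Az]] := xP _ xx0; exists A; split => //; exists x0.
- by move=> A [mA _ Ax [z Az xz]]; exact: (wac_module_open wacX mA Ax Az xz).
- move=> A B [mA nA Ax [z Az xz]] [mB nB Bx _]; exists (A `|` B) => //; split.
  + exact: (module_setU ctX mA mB Ax Bx).
  + exact: (proper_module_setU mA mB nA nB Ax Bx).
  + by left.
  + by exists z => //; left.
- move=> z; have [<-|/eqP xz] := eqVneq x z.
    by have [A [mA nA Ax Az]] := xP _ xx0; exists A => //; split => //; exists x0.
  by have [A [mA nA Ax Az]] := xP _ xz; exists A => //; split => //; exists z.
Qed.

(** The fibres of a quotient map onto a nontrivial tournament are proper
    modules, so its kernel is contained in [cohabit]. *)
Lemma cohabit_quotient_prime (Z : relSpace) (q : X -> Z) :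
  quotient_map q -> (forall x x', q x = q x' <-> cohabit x x') ->
  prime_tournament Z.
Proof.
move=> qq qE; split; first exact: qm_cod qq.
- have [x _] := ct_ex ctX; apply/(not_trivialP (q x)).
  have /existsNP[y nxy] : ~ forall y, cohabit x y.
    by move=> xT; apply: (@cohabit_class_proper x); rewrite eqEsubset; split => // y _; exact: xT.
  by exists (q y) => /qE.
- move=> W r ntW qr; split => // z z'.
  have [x <-] := qm_surj qq z; have [x' <-] := qm_surj qq z'; move=> e.
  by apply/qE; apply: (fibre_cohabit (quotient_map_comp qq qr)).
Qed.

Lemma prime_quotient_exists :
  exists (Z : relSpace) (q : X -> Z), prime_quotient_map q.
Proof.
have [Z [q [qq qE]]] := module_quotient_exists wacX cohabit_refl cohabit_sym
  cohabit_trans cohabit_module.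
by exists Z, q; split => //; exact: cohabit_quotient_prime qE.
Qed.

(** The quotient by [cohabit] factors through [h], and the factor is injective
    because [Y] is prime. *)
Lemma prime_kernel (Y : relSpace) (h : X -> Y) (x x' : X) :
  prime_quotient_map h -> (h x = h x' <-> cohabit x x').
Proof.
move=> [qh [_ ntY prY]]; have fib := fibre_cohabit qh ntY.
split=> [|xx']; first exact: fib.
have [Z [q [qq qE]]] := module_quotient_exists wacX cohabit_refl cohabit_sym
  cohabit_trans cohabit_module.
have [|r qr rE] := quotient_map_factor qh qq; first by move=> u v /fib /qE.
have [_ ntZ _] := cohabit_quotient_prime qq qE.
have [_ ir] := prY _ _ ntZ qr.
by apply: ir; rewrite -/((r \o h) x) -/((r \o h) x') !rE; exact/qE.
Qed.

End Prime.

(** * Base quotient maps *)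

Lemma arc_quotient_nontrivial (X : relSpace) :
  has_arc_quotient X -> ~ trivial_tournament X.
Proof.
move=> [Y [h [[y [y' [yy' _]]] qh]]] [x Xx].
have [u hu] := qm_surj qh y; have [v hv] := qm_surj qh y'.
have : [set: X] u by []; have : [set: X] v by []; rewrite Xx /= => vx ux.
by apply: yy'; rewrite -hu -hv vx ux.
Qed.

Section Base.
Variables (X : relSpace) (wacX : wac_tournament X).
Let ctX := wac_ct wacX.

Lemma base_quotient_exists :
  exists (Y : relSpace) (h : X -> Y), base_quotient_map h.
Proof.
have [tX|ntX] := pselect (trivial_tournament X).
  exists X, id; split=> [[]//|/arc_quotient_nontrivial//|_]; split => //.
  by have [] := id_isomorphism ctX.
have [aX|naX] := pselect (has_arc_quotient X).
  have [Y [h mh]] := maximum_order_quotient_exists wacX aX.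
  by exists Y, h; split => // -[].
have [Y [h mh]] := prime_quotient_exists wacX naX ntX.
by exists Y, h.
Qed.

Lemma base_cases (Y : relSpace) (h : X -> Y) : base_quotient_map h ->
  [\/ ~ trivial_tournament X /\ ~ has_arc_quotient X /\ prime_quotient_map h,
      has_arc_quotient X /\ maximum_order_quotient_map h |
      trivial_tournament X /\ quotient_map h /\ trivial_tournament Y].
Proof.
move=> [h1 h2 h3]; have [tX|ntX] := pselect (trivial_tournament X).
  by apply: Or33; split => //; exact: h3.
have [aX|naX] := pselect (has_arc_quotient X); first by apply: Or32; split => //; exact: h2.
by apply: Or31; split => //; split => //; exact: h1.
Qed.

Lemma base_quotient_map_quotient (Y : relSpace) (h : X -> Y) :
  base_quotient_map h -> quotient_map h.
Proof. by move=> /base_cases[[_ [_ []]]|[_ []]|[_ []]]. Qed.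

Lemma base_factor_cases (Y : relSpace) (h : X -> Y) : base_quotient_map h ->
  [\/ prime_tournament Y, nontrivial_finite_order Y |
      ct_tournament Y /\ trivial_tournament Y].
Proof.
move=> bh; have ctY := qm_cod (base_quotient_map_quotient bh).
case: (base_cases bh) => [[_ [_ [_ ?]]]|[_ [_ ? _]]|[_ [_ ?]]].
- exact: Or31.
- exact: Or32.
- exact: Or33.
Qed.

Lemma base_nontrivial (Y : relSpace) (h : X -> Y) : base_quotient_map h ->
  ~ trivial_tournament X -> ~ trivial_tournament Y.
Proof. by move=> /base_cases[[_ [_ [_ []]]]|[_ [_ []]]|[]]. Qed.

Lemma base_kernel_unique (Y Y' : relSpace) (h : X -> Y) (h' : X -> Y') (x x' : X) :
  base_quotient_map h -> base_quotient_map h' -> (h x = h x' <-> h' x = h' x').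
Proof.
move=> /base_cases bh [h1 h2 h3].
case: bh => [[ntX [naX ph]]|[aX mh]|[tX [qh tY]]].
- have ph' := h1 (conj ntX naX).
  by rewrite (prime_kernel wacX naX ntX _ _ ph) (prime_kernel wacX naX ntX _ _ ph').
- have mh' := h2 aX.
  by rewrite (maximum_order_kernel wacX _ _ mh) (maximum_order_kernel wacX _ _ mh').
- have [z Xz] := tX; have : [set: X] x by []; have : [set: X] x' by [].
  by rewrite Xz /= => -> ->.
Qed.

(** Being a base quotient map depends only on the kernel. *)
Lemma base_quotient_transfer (Y Y' : relSpace) (h : X -> Y) (h' : X -> Y') :
  base_quotient_map h -> quotient_map h' ->
  (forall x x', h x = h x' <-> h' x = h' x') -> base_quotient_map h'.
Proof.
move=> bh qh' hh'; have qh := base_quotient_map_quotient bh.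
have [q [qq iq] qE] := quotient_map_iso qh qh' hh'.
have ntq : ~ trivial_tournament Y -> ~ trivial_tournament Y'.
  have [y _] := ct_ex (qm_cod qh).
  move=> /(not_trivialP y)[y' yy']; apply/(not_trivialP (q y)).
  by exists (q y') => /iq.
have [h1 h2 h3] := bh; split=> [hX|aX|tX].
- have [_ [ctY ntY prY]] := h1 hX; split => //; split.
  + exact: qm_cod qh'.
  + exact: ntq.
  + move=> W k ntW qk; split => // z z'.
    have [y <-] := qm_surj qq z; have [y' <-] := qm_surj qq z'; move=> e.
    have [_ ikq] := prY _ _ ntW (quotient_map_comp qq qk).
    by congr q; exact: ikq.
- have [_ [[ctY trY] finY ntY] fib] := h2 aX; split => //.
    split; last exact: ntq.
      split; first exact: qm_cod qh'.
      move=> z1 z2 z3; have [y1 <-] := qm_surj qq z1; have [y2 <-] := qm_surj qq z2.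
      have [y3 <-] := qm_surj qq z3; move=> t12 t23.
      have [->|n12] := pselect (y1 = y2); first exact: t23.
      have [<-|n23] := pselect (y2 = y3); first exact: t12.
      by apply: (qm_tr qq); apply: (trY _ y2); apply: (qm_lift qq) => // /iq.
    have -> : [set: Y'] = q @` setT.
      by rewrite eqEsubset; split => // z _; have [y <-] := qm_surj qq z; exists y.
    exact: finite_image.
  move=> z; have [y <-] := qm_surj qq z.
  suff -> : h' @^-1` [set q y] = h @^-1` [set y] by exact: fib.
  by rewrite predeqE => x /=; rewrite -qE; split=> [/iq|<-].
- have [_ tY] := h3 tX; split => //; have [y Yy] := tY; exists (q y).
  rewrite eqEsubset; split => // z _; have [y' <-] := qm_surj qq z.
  by have : [set: Y] y' by []; rewrite Yy => /= ->.
Qed.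

End Base.

(** * Lexicographic products of base quotients of the fibres *)

Lemma fibre_wac (X Z : relSpace) (h : X -> Z) (z : Z) :
  wac_tournament X -> quotient_map h -> wac_tournament (restr (h @^-1` [set z])).
Proof.
move=> wacX qh; apply: restr_wac => //; first exact: module_fibre.
by have [x hx] := qm_surj qh z; exists x.
Qed.

(** A fibre with two points is open, and its image is then an open point. *)
Lemma fibre_trivial (X Z : relSpace) (h : X -> Z) (z : Z) :
  wac_tournament X -> quotient_map h -> ~ open [set z] ->
  trivial_tournament (restr (h @^-1` [set z])).
Proof.
move=> wacX qh nz; have [x hx] := qm_surj qh z.
have mF : module (h @^-1` [set z]) by exact: module_fibre.
have [F1|[oF _]] := wac_module_cases wacX mF hx; last first.
  by case: nz; exact: qm_open_fibre oF.
have [t tx] := restr_ex (hx : (h @^-1` [set z]) x).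
exists t; rewrite eqEsubset; split => // s _; apply: restr_inj.
have sF : h @^-1` [set z] `<=` [set x] by rewrite F1.
by rewrite tx; apply: sF; exact: restr_valP.
Qed.

Section LexProduct.
Variables (X : relSpace) (Y : X -> relSpace).

(** [lex_fst] with the product topology on its source. *)
Definition lex_proj : lex_product Y -> X := @lex_fst X Y.

Lemma lex_base_open (W : set (lex_product Y)) : lex_base W -> open W.
Proof.
move=> bW; exists [set W]; first by move=> _ ->.
by rewrite bigcup_set1.
Qed.

Lemma lex_openE (W : set (lex_product Y)) : open W ->
  exists2 D : set (set (lex_product Y)), D `<=` @lex_base X Y & \bigcup_(V in D) V = W.
Proof. by move=> [D sD DW]; exists D. Qed.

Lemma lex_fst_continuous : continuous (@lex_fst X Y : lex_product Y -> X).
Proof.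
apply/continuousP => V oV; apply: lex_base_open; left; exists V => //.
Qed.

Lemma lex_tr_fst (p q : lex_product Y) : ct_tournament X ->
  tr (lex_product Y) (p, q) -> tr X (lex_fst p, lex_fst q).
Proof.
move=> ctX [[]//|[x [y [y' [[-> ->] _]]]]].
exact: tr_refl ctX x.
Qed.

Lemma lex_tr_snd (x : X) (u u' : Y x) :
  tr (lex_product Y) (existT _ x u, existT _ x u') -> tr (Y x) (u, u').
Proof.
case=> [[_ /= nx]|[z [y [y' [e t]]]]]; first by case: nx; exact/diagonalP.
have e1 : existT Y x u = existT Y z y := congr1 fst e.
have e2 : existT Y x u' = existT Y z y' := congr1 snd e.
have zx : z = x := esym (congr1 (@projT1 _ _) e1).
subst z; have -> : u = y by apply: eq_from_Tagged e1.
by have -> : u' = y' by apply: eq_from_Tagged e2.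
Qed.

(** Two points over the same [x] can be separated in [Y x] if [x] is isolated;
    otherwise [Y x] is a singleton. *)
Lemma lex_hausdorff : ct_lex_conditions Y -> hausdorff_space (lex_product Y).
Proof.
move=> [ctX ctY trivY] p q cl.
have : lex_fst p = lex_fst q.
  apply: (ct_hausdorff ctX) => U V nU nV.
  have [t [? ?]] := cl _ _ (lex_fst_continuous nU) (lex_fst_continuous nV).
  by exists (lex_fst t).
case: p q cl => x y [x' y'] cl /= e; subst x'; congr existT.
have [ix|/trivY[y0 Yy0]] := pselect (isolated [set: X] x); last first.
  have : [set: Y x] y by []; have : [set: Y x] y' by [].
  by rewrite Yy0 /= => -> ->.
apply: (ct_hausdorff (ctY x)) => U V.
rewrite !nbhsE => -[U' [oU' Uy] sU] [V' [oV' Vy'] sV].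
have im (W : set (Y x)) w : open W -> W w ->
    nbhs (existT _ x w : lex_product Y) (existT (fun x => Y x) x @` W).
  move=> oW Ww; apply: open_nbhs_nbhs; split; last by exists w.
  by apply: lex_base_open; right; exists x, W.
have [t [[u Uu ut] [v Vv vt]]] := cl _ _ (im _ _ oU' Uy) (im _ _ oV' Vy').
have uv : u = v by apply: eq_from_Tagged (etrans ut (esym vt)).
by exists u; split; [exact: sU|apply: sV; rewrite uv].
Qed.

End LexProduct.

Section Step.
Variables (X Z : relSpace) (h : X -> Z) (wacX : wac_tournament X) (qh : quotient_map h).
Variables (Y : Z -> relSpace) (g : forall z, restr (h @^-1` [set z]) -> Y z).
Hypothesis bg : forall z, base_quotient_map (@g z).
Arguments g : clear implicits.

Lemma mem_fibre x : x \in h @^-1` [set h x]. Proof. by rewrite inE. Qed.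

(** The refinement of [h] by the maps [g z] on its fibres. *)
Definition lex_lift (x : X) : lex_product Y :=
  existT _ (h x) (g (h x) (exist _ x (mem_fibre x))).

Let qg z : quotient_map (g z).
Proof. exact: base_quotient_map_quotient (@bg z). Qed.

Lemma lex_liftE z (t : restr (h @^-1` [set z])) :
  lex_lift (set_val t) = existT _ z (g z t).
Proof.
case: t => x xz; have e : h x = z by exact: (set_mem xz).
subst z; rewrite /lex_lift; congr existT; congr (g _ _).
exact: val_inj.
Qed.

Lemma lex_lift_fst x : lex_fst (lex_lift x) = h x. Proof. by []. Qed.

Lemma lex_conditions : ct_lex_conditions Y.
Proof.
split; first exact: qm_cod qh.
  by move=> z; exact: qm_cod (qg z).
move=> z /isolated_setTP nz.
have [_ _ /(_ (fibre_trivial wacX qh nz))[]] := @bg z.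
by [].
Qed.

(** A basic open set over an isolated [z] pulls back to a subset of the fibre
    over [z], which is open. *)
Lemma lex_lift_continuous : continuous lex_lift.
Proof.
apply/continuousP => W /lex_openE[D sD <-]; rewrite preimage_bigcup.
apply: bigcup_open => V /sD[[U oU <-]|[z [U [/isolated_setTP oz oU ->]]]].
  by move/continuousP: (qm_cont qh) => /(_ _ oU).
have /restr_open[U' oU' U'E] : open (g z @^-1` U).
  by move/continuousP: (qm_cont (qg z)); apply.
suff -> : lex_lift @^-1` (existT (fun z => Y z) z @` U) = U' `&` h @^-1` [set z].
  by apply: openI => //; move/continuousP: (qm_cont qh); apply.
rewrite predeqE => x; split=> [[u Uu ux]|[U'x hx]].
  have hx : h x = z by rewrite -(lex_lift_fst x) -ux.
  have [t tx] := restr_ex (hx : (h @^-1` [set z]) x).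
  split => //; suff : (g z @^-1` U) t by rewrite -U'E /= tx.
  move: ux; rewrite -tx lex_liftE => ux.
  have ug : u = g z t by apply: eq_from_Tagged ux.
  by rewrite /preimage /= -ug.
have [t tx] := restr_ex (hx : (h @^-1` [set z]) x).
rewrite -tx /= lex_liftE; exists (g z t) => //.
by have : (g z @^-1` U) t by rewrite -U'E /= tx.
Qed.

Lemma lex_lift_quotient : quotient_map lex_lift.
Proof.
have [ctZ ctY _] := lex_conditions.
apply: quotient_mapI.
- exact: wac_ct wacX.
- exact: lex_hausdorff lex_conditions.
- move=> [x u] [x' u'] t t'.
  have xx' : x = x'.
    by apply: (tr_anti ctZ); [exact: (lex_tr_fst ctZ t)|exact: (lex_tr_fst ctZ t')].
  subst x'; congr existT; apply: (tr_anti (ctY x)); exact: lex_tr_snd.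
- move=> [z y] _; have [t <-] := qm_surj (qg z) y.
  by exists (set_val t) => //; exact: lex_liftE.
- exact: lex_lift_continuous.
- move=> x x' xx'; have [e|ne] := pselect (h x = h x').
    have [t tx] := restr_ex (erefl : (h @^-1` [set h x]) x).
    have [t' tx'] := restr_ex (esym e : (h @^-1` [set h x]) x').
    right; exists (h x), (g _ t), (g _ t'); split.
      by rewrite -!lex_liftE tx tx'.
    by apply: (qm_tr (qg _)); rewrite /= tx tx'.
  left; split; first exact: (qm_tr qh).
  by move=> /diagonalP.
Qed.

Lemma lex_fst_quotient : quotient_map (@lex_fst Z Y : lex_product Y -> Z).
Proof.
have [ctZ _ _] := lex_conditions.
apply: quotient_mapI.
- exact: qm_cod lex_lift_quotient.
- exact: ct_hausdorff ctZ.
- exact: tr_anti ctZ.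
- by move=> z _; have [x <-] := qm_surj qh z; exists (lex_lift x).
- exact: lex_fst_continuous.
- by move=> p q; exact: lex_tr_fst.
Qed.

(** On the fibre over [z], the lift has the same kernel as [g z]. *)
Lemma lex_lift_base z :
  exists k : restr (h @^-1` [set z]) -> restr (@lex_proj Z Y @^-1` [set z]),
    (forall t, set_val (k t) = lex_lift (set_val t)) /\ base_quotient_map k.
Proof.
have wF := fibre_wac z wacX qh.
pose F := restr (h @^-1` [set z]).
have mk (t : F) : lex_lift (set_val t) \in (@lex_proj Z Y @^-1` [set z]).
  by rewrite inE /=; exact: (restr_valP t).
pose k (t : F) : restr (@lex_proj Z Y @^-1` [set z]) :=
  exist _ (lex_lift (set_val t)) (mk t).
have kE t : set_val (k t) = lex_lift (set_val t) by [].
have kk (t t' : F) : g z t = g z t' <-> k t = k t'.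
  split=> [e|/(congr1 set_val)]; first by apply: restr_inj; rewrite !kE !lex_liftE e.
  by rewrite !kE !lex_liftE => e; apply: eq_from_Tagged e.
exists k; split => //; apply: (base_quotient_transfer (@bg z)) => //.
have ctL := qm_cod lex_lift_quotient.
apply: quotient_mapI.
- exact: wac_ct wF.
- exact/restr_hausdorff/ct_hausdorff.
- by move=> s s' ss' s's; apply: restr_inj; exact: (tr_anti ctL).
- move=> s _; have [x xs] := qm_surj lex_lift_quotient (set_val s).
  have hx : h x = z by rewrite -lex_lift_fst xs; exact: (restr_valP s).
  have [t tx] := restr_ex (hx : (h @^-1` [set z]) x).
  by exists t => //; apply: restr_inj; rewrite kE tx.
- apply: continuous_to_restr => t.
  exact: (continuous_comp (@restr_continuous _ _ t) (@lex_lift_continuous _)).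
- by move=> t t' tt'; exact: (qm_tr lex_lift_quotient).
Qed.

End Step.

(** * Construction of a classifier system *)

(** The identity is a default value, so that the recursion below can be written
    before anything is known about the fibres. *)
Definition base_of (X : relSpace) : {Y : relSpace & X -> Y} :=
  match pselect (exists p : {Y : relSpace & X -> Y}, base_quotient_map (projT2 p)) with
  | left e => projT1 (cid e)
  | right _ => existT (fun Y : relSpace => X -> Y) X id
  end.

Lemma base_ofP (X : relSpace) : wac_tournament X ->
  base_quotient_map (projT2 (base_of X)).
Proof.
move=> wacX; rewrite /base_of; case: pselect => [e|[]]; first exact: (projT2 (cid e)).
by have [Y [h bh]] := base_quotient_exists wacX; exists (existT _ Y h).
Qed.

Section Construction.
Variables (X : relSpace) (wacX : wac_tournament X).

Definition fibre_base (Z : relSpace) (h : X -> Z) (z : Z) :=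
  base_of (restr (h @^-1` [set z])).

(** Space and map are built together, as the next space depends on the map. *)
Fixpoint stage (i : nat) : {Z : relSpace & X -> Z} :=
  if i is j.+1 then
    let h := projT2 (stage j) in
    existT (fun Z : relSpace => X -> Z)
      (lex_product (fun z => projT1 (fibre_base h z)))
      (lex_lift (fun z => projT2 (fibre_base h z)))
  else base_of X.

Definition stage_space i : relSpace := projT1 (stage i).
Definition stage_map i : X -> stage_space i := projT2 (stage i).
Definition stage_proj i : stage_space i.+1 -> stage_space i :=
  @lex_proj (stage_space i) (fun z => projT1 (fibre_base (@stage_map i) z)).

Lemma stage_quotient i : quotient_map (@stage_map i).
Proof.
elim: i => [|i IH]; first exact/base_quotient_map_quotient/base_ofP.
apply: lex_lift_quotient => // z; exact/base_ofP/fibre_wac.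
Qed.

Lemma stage_base i z : base_quotient_map (projT2 (fibre_base (@stage_map i) z)).
Proof. exact/base_ofP/fibre_wac/stage_quotient. Qed.

Lemma stage_classifier : classifier_system stage_proj stage_map.
Proof.
split; split.
- by move=> i; exact: qm_cod (stage_quotient i).
- by move=> i; exact: (lex_fst_quotient wacX (stage_quotient i) (@stage_base i)).
- exact: stage_quotient.
- by [].
- exact: base_ofP.
- move=> i x; split; first exact: fibre_wac (stage_quotient i).
  exact: (lex_lift_base wacX (stage_quotient i) (@stage_base i)).
Qed.

Lemma stage_lex i : is_ct_lex_product
  (fun z => projT1 (fibre_base (@stage_map i) z)) (@stage_proj i).
Proof.
split=> //; exact: (lex_conditions wacX (stage_quotient i) (@stage_base i)).
Qed.

Lemma stage_factor_cases i (z : stage_space i) :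
  let Y := projT1 (fibre_base (@stage_map i) z) in
  [\/ prime_tournament Y, nontrivial_finite_order Y
    | ct_tournament Y /\ trivial_tournament Y].
Proof. exact: base_factor_cases (@stage_base i z). Qed.

End Construction.

(** * Uniqueness of classifier systems *)

Section Uniqueness.
Variable X : relSpace.

(** [base_kernel_unique] across two descriptions of the same fibre. *)
Lemma fibre_base_kernel (A A' : set X) (Y Y' : relSpace)
    (g : restr A -> Y) (g' : restr A' -> Y') :
  A = A' -> wac_tournament (restr A) -> base_quotient_map g -> base_quotient_map g' ->
  forall t t' s s', set_val t = set_val s -> set_val t' = set_val s' ->
  g t = g t' -> g' s = g' s'.
Proof.
move=> AA'; subst A' => wA bg bg' t t' s s' /restr_inj <- /restr_inj <-.
by move=> e; apply/(base_kernel_unique wA _ _ bg bg').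
Qed.

Lemma classifier_kernel_step (Xs Xs' : nat -> relSpace)
    (f : forall i, Xs i.+1 -> Xs i) (h : forall i, X -> Xs i)
    (f' : forall i, Xs' i.+1 -> Xs' i) (h' : forall i, X -> Xs' i) i :
  classifier_system f h -> classifier_system f' h' ->
  (forall x x', h i x = h i x' <-> h' i x = h' i x') ->
  forall x x', h i.+1 x = h i.+1 x' -> h' i.+1 x = h' i.+1 x'.
Proof.
move=> [_ [hf _ fib]] [_ [_ _ fib']] IH x x' e.
have e0 : h i x = h i x' by rewrite !hf /= e.
have [wA [g [gE bg]]] := fib i (h i x).
have [_ [g' [gE' bg']]] := fib' i (h' i x).
have AA' : h i @^-1` [set h i x] = h' i @^-1` [set h' i x].
  by rewrite predeqE => z /=; exact: IH.
have [t tx] := restr_ex (erefl : (h i @^-1` [set h i x]) x).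
have [t' tx'] := restr_ex (esym e0 : (h i @^-1` [set h i x]) x').
have [s sx] := restr_ex (erefl : (h' i @^-1` [set h' i x]) x).
have [s' sx'] := restr_ex (esym ((IH _ _).1 e0) : (h' i @^-1` [set h' i x]) x').
rewrite -sx -sx' -!gE'; congr set_val.
apply: (fibre_base_kernel AA' wA bg bg' (t := t) (t' := t')); rewrite ?tx ?tx' //.
by apply: restr_inj; rewrite !gE tx tx'.
Qed.

Hypothesis wacX : wac_tournament X.

(** By induction the fibres of [h i] and [h' i] agree, and the maps of level
    [i.+1] restrict on each of them to base quotient maps, which have the same
    kernel. *)
Lemma classifier_kernel (Xs Xs' : nat -> relSpace)
    (f : forall i, Xs i.+1 -> Xs i) (h : forall i, X -> Xs i)
    (f' : forall i, Xs' i.+1 -> Xs' i) (h' : forall i, X -> Xs' i) i x x' :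
  classifier_system f h -> classifier_system f' h' ->
  (h i x = h i x' <-> h' i x = h' i x').
Proof.
move=> cs cs'; elim: i x x' => [|i IH] x x'.
  case: cs cs' => [_ [_ b _]] [_ [_ b' _]].
  exact: base_kernel_unique.
split; first exact: (classifier_kernel_step cs cs').
by apply: (classifier_kernel_step cs' cs) => u v; apply: iff_sym.
Qed.

Lemma classifier_unique (Xs Xs' : nat -> relSpace)
    (f : forall i, Xs i.+1 -> Xs i) (h : forall i, X -> Xs i)
    (f' : forall i, Xs' i.+1 -> Xs' i) (h' : forall i, X -> Xs' i) :
  classifier_system f h -> classifier_system f' h' ->
  exists q : forall i, Xs i -> Xs' i,
    forall i, [/\ isomorphism (q i),
                  f' i \o q i.+1 =1 q i \o f i &
                  q i \o h i =1 h' i].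
Proof.
move=> cs cs'; have [[_ _ qh] [hf _ _]] := cs; have [[_ _ qh'] [hf' _ _]] := cs'.
have ex i : exists q : Xs i -> Xs' i, isomorphism q /\ q \o h i =1 h' i.
  have [q iq qE] := quotient_map_iso (qh i) (qh' i)
    (fun x x' => classifier_kernel i x x' cs cs').
  by exists q.
exists (fun i => projT1 (cid (ex i))) => i.
have [iq qE] := projT2 (cid (ex i)); have [_ qE'] := projT2 (cid (ex i.+1)).
split => // y; have [x <-] := qm_surj (qh i.+1) y => /=.
by have := qE' x; rewrite /= => ->; rewrite -[LHS]/((f' i \o h' i.+1) x) -hf' -qE /= hf.
Qed.

End Uniqueness.

(** * The inverse limit of a classifier system *)

Section InverseLimit.
Variables (X : relSpace) (wacX : wac_tournament X).
Variables (Xs : nat -> relSpace) (f : forall i, Xs i.+1 -> Xs i) (h : forall i, X -> Xs i).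
Hypothesis cs : classifier_system f h.
Arguments f : clear implicits.
Arguments h : clear implicits.
Let ctX := wac_ct wacX.

Let qh i : quotient_map (h i). Proof. by case: cs => -[]. Qed.
Let hf i : h i =1 f i \o h i.+1. Proof. by case: cs => _ []. Qed.

Lemma thread_le (p : forall i, Xs i) x i j : (forall k, f k (p k.+1) = p k) ->
  (i <= j)%N -> h j x = p j -> h i x = p i.
Proof.
move=> fp; elim: j => [|j IH]; first by rewrite leqn0 => /eqP ->.
rewrite leq_eqVlt ltnS => /orP[/eqP ->//|ij] e; apply: IH ij _.
by rewrite hf /= e fp.
Qed.

(** If no [h i] separates x from x', the fibres [A i] through x decrease to a
    module [B] with two points, so [B] is open and equals some [A i] by
    compactness. Then [h i.+1] is constant on [A i], although it restricts there
    to a base quotient map of a nontrivial tournament. *)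
Lemma classifier_separates x x' : (forall i, h i x = h i x') -> x = x'.
Proof.
move=> e; apply: contrapT => xx'.
pose A i := h i @^-1` [set h i x].
pose B := \bigcap_i A i.
have Ax i : A i x by [].
have Ax' i : A i x' by exact: esym.
have mA i : module (A i) by exact: module_fibre.
have decA i j : (i <= j)%N -> A j `<=` A i.
  by move=> ij u; apply: (@thread_le (fun k => h k x)) => // k; rewrite (hf k).
have mB : module B.
  move=> w /existsNP[i /not_implyP[_ nw]].
  by have [wA|Aw] := mA i w nw; [left|right] => b Bb; [apply: wA|apply: Aw]; exact: Bb.
have [oB _] : clopen B by apply: (wac_module_clopen wacX mB _ _ xx') => i _.
have [i BT] : [set U | exists i, U = B `|` ~` A i] setT.
  apply: (compact_directed_cover (ct_compact ctX)).
  - by exists (B `|` ~` A 0); exists 0.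
  - move=> U [i ->]; apply: openU => //.
    exact/closed_openC/(qm_closed_fibre (qh i)).
  - move=> U V [i ->] [j ->]; exists (B `|` ~` A (maxn i j)); first by exists (maxn i j).
    move=> u [[?|nA]|[?|nA]]; [by left|right|by left|right] => uA; apply: nA.
      by apply: decA uA; exact: leq_maxl.
    by apply: decA uA; exact: leq_maxr.
  - move=> u; have [Bu|/existsNP[i /not_implyP[_ nAu]]] := pselect (B u).
      by exists (B `|` ~` A 0); [exists 0|left].
    by exists (B `|` ~` A i); [exists i|right].
have AB u : A i u -> B u.
  by move=> Au; have : [set: X] u by []; rewrite BT => -[].
have [_ [_ _ fib]] := cs; have [wA [g [gE bg]]] := fib i (h i x).
have [t tx] := restr_ex (Ax i); have [t' tx'] := restr_ex (Ax' i).
have ntA : ~ trivial_tournament (restr (A i)).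
  by apply/(not_trivialP t); exists t' => tt'; apply: xx'; rewrite -tx -tx' tt'.
apply: (base_nontrivial bg ntA); exists (g t).
rewrite eqEsubset; split => // z _ /=.
have [s <-] := qm_surj (base_quotient_map_quotient bg) z.
apply: restr_inj; rewrite !gE tx.
exact: (AB _ (restr_valP s) i.+1 I).
Qed.

(** The fibres over a thread are nonempty, closed and nested. *)
Lemma thread_realized (p : forall i, Xs i) : (forall i, f i (p i.+1) = p i) ->
  exists x, forall i, h i x = p i.
Proof.
move=> fp; apply: contrapT => nx.
have [i iT] : [set U : set X | exists i, U = ~` (h i @^-1` [set p i])] setT.
  apply: (compact_directed_cover (ct_compact ctX)).
  - by exists (~` (h 0 @^-1` [set p 0])); exists 0.
  - move=> U [i ->]; exact/closed_openC/(qm_closed_fibre (qh i)).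
  - move=> U V [i ->] [j ->]; exists (~` (h (maxn i j) @^-1` [set p (maxn i j)])).
      by exists (maxn i j).
    move=> u /= [nA|nA] uA; apply: nA.
      by apply: (thread_le fp _ uA); exact: leq_maxl.
    by apply: (thread_le fp _ uA); exact: leq_maxr.
  - move=> u; have /existsNP[i nu] : ~ forall i, h i u = p i.
      by move=> hu; apply: nx; exists u.
    by exists (~` (h i @^-1` [set p i])); [exists i|].
have [x hx] := qm_surj (qh i) (p i).
by have : [set: X] x by []; rewrite iT; apply.
Qed.

Lemma classifier_inverse_limit : exists g : X -> inverse_limit f,
  (forall x i, set_val (g x) i = h i x) /\ isomorphism g.
Proof.
have thr x : (fun i => h i x : Xs i) \in
    [set p : product_relSpace Xs | forall i, f i (p i.+1) = p i].
  by rewrite inE => i; exact/esym/hf.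
exists (fun x => exist _ (fun i => h i x) (thr x)); split => //; split; last first.
  move=> x x' e; apply: classifier_separates => i.
  exact: (congr1 (fun p : inverse_limit f => set_val p i) e).
apply: quotient_mapI => //.
- apply: restr_hausdorff; apply: hausdorff_product => i.
  exact: (ct_hausdorff (qm_cod (qh i))).
- move=> p q pq qp; apply: restr_inj; apply: functional_extensionality_dep => i.
  by apply: (tr_anti (qm_cod (qh i))); [exact: pq|exact: qp].
- move=> p _; have [x hx] := thread_realized (restr_valP p).
  exists x => //; apply: restr_inj; apply: functional_extensionality_dep => i.
  exact: hx.
- apply: continuous_to_restr => x /=; apply/cvg_sup => i.
  move=> U [_ [[C oC <-] Cx sU]].
  have : nbhs x (h i @^-1` C) by exact: (qm_cont (qh i) (open_nbhs_nbhs (conj oC Cx))).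
  by apply: filterS => u Cu; exact: sU.
- by move=> x x' xx' i; exact: (qm_tr (qh i)).
Qed.

End InverseLimit.

Unset Implicit Arguments.

Theorem theorem1p9 (X : relSpace) (wacX : wac_tournament X) :
  [/\ (exists (Xs : nat -> relSpace) (f : forall i, Xs i.+1 -> Xs i)
         (h : forall i, X -> Xs i), classifier_system f h),
      (forall (Xs : nat -> relSpace) (f : forall i, Xs i.+1 -> Xs i)
         (h : forall i, X -> Xs i)
         (Xs' : nat -> relSpace) (f' : forall i, Xs' i.+1 -> Xs' i)
         (h' : forall i, X -> Xs' i),
         classifier_system f h -> classifier_system f' h' ->
         exists q : forall i, Xs i -> Xs' i,
           forall i, [/\ isomorphism (q i),
                         f' i \o q i.+1 =1 q i \o f i &
                         q i \o h i =1 h' i]),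
      (forall (Xs : nat -> relSpace) (f : forall i, Xs i.+1 -> Xs i)
         (h : forall i, X -> Xs i),
         classifier_system f h ->
         exists g : X -> inverse_limit f,
           (forall x i, set_val (g x) i = h i x) /\ isomorphism g) &
      (exists (Xs : nat -> relSpace) (f : forall i, Xs i.+1 -> Xs i)
         (h : forall i, X -> Xs i),
         classifier_system f h /\
         forall i, exists Y : Xs i -> relSpace,
           is_ct_lex_product Y (f i) /\
           forall x : Xs i,
             [\/ prime_tournament (Y x), nontrivial_finite_order (Y x)
               | ct_tournament (Y x) /\ trivial_tournament (Y x)])].
Proof.
have stageX := stage_classifier wacX.
split.
- by exists (stage_space X), (@stage_proj X), (@stage_map X).
- by move=> Xs f h Xs' f' h'; exact: classifier_unique.
- by move=> Xs f h; exact: classifier_inverse_limit.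
- exists (stage_space X), (@stage_proj X), (@stage_map X); split=> // i.
  exists (fun z => projT1 (fibre_base (@stage_map X i) z)); split.
    exact: stage_lex.
  exact: stage_factor_cases.
Qed.
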